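(* Let $d\ge 3$ be an odd integer and let $\mathcal{C}_n$ denote the cyclic group $\mathbb{Z}/n\mathbb{Z}$. Then, for every $k\ge 1$, $$\mathrm{St}_{G_d}(\widehat{k})/\mathrm{Rist}_{G_d}(\widehat{k})\;\cong\;\prod_{i=1}^{d^k-1}\mathcal{C}_{\alpha_i},$$ where $\alpha_i=2^{k+1}$ if $d\nmid i$, and otherwise $\alpha_i=2^{k-s}$, where $i=d^sr$ with $s\ge 1$ and $d\nmid r$. Hence $[\mathrm{St}_{G_d}(\widehat{k}):\mathrm{Rist}_{G_d}(\widehat{k})]=2^t$, where $$t=\frac{(k+1)d^{k+1}-(k+3)d^k+d^{k-1}+1}{d-1}.$$
   Context: Let $d\ge 3$ be odd and $X=\{1,\dots,d\}$. Let $T$ be the $d$-regular rooted tree whose vertex set is the set $X^*$ of finite words over $X$, with root the empty word, the children of $u$ being $ux$, $x\in X$; $X^k$ is the $k$-th level. $\mathrm{Aut}(T)$ is the group of root-preserving graph automorphisms of $T$, with product $gh(u)=h(g(u))$ and identity $e$. For $g\in\mathrm{Aut}(T)$ and $u\in X^*$, the section $g|_u\in\mathrm{Aut}(T)$ is determined by $g(uv)=g(u)\,g|_u(v)$ for all $v\in X^*$. The wreath recursion of $g$ is $g=(g|_1,\dots,g|_d)\lambda_g$, where $\lambda_g\in S_d$ is the permutation induced by $g$ on $X$; it determines $g$. The group $G_d\le \mathrm{Aut}(T)$ is generated by $A=\{a_1,\dots,a_d\}$, defined recursively by: for $1\le i\le d-1$, $\lambda_{a_i}=(i\ \,i+1)$,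 $a_i|_i=a_i$, $a_i|_{i+1}=a_{i+1}$, and $a_i|_x=e$ for all other $x\in X$; and $\lambda_{a_d}=(d\ 1)$, $a_d|_1=a_1$, $a_d|_d=a_d$, and $a_d|_x=e$ for all other $x\in X$. $\mathrm{St}_{G_d}(\widehat{k})$ is the subgroup of elements of $G_d$ fixing every vertex of $X^k$. For a vertex $u$, $\mathrm{Rist}_{G_d}(u)$ is the subgroup of elements of $G_d$ fixing every vertex not of the form $uv$ with $v\in X^*$; $\mathrm{Rist}_{G_d}(\widehat{k})$ is the (normal) subgroup generated by all $\mathrm{Rist}_{G_d}(u)$, $u\in X^k$. *)

(* Defs.v *)
From HB Require Import structures.
From mathcomp Require Import all_boot all_order all_algebra all_fingroup.
From mathcomp Require Import boolp classical_sets functions cardinality.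

Set Implicit Arguments.
Unset Strict Implicit.
Unset Printing Implicit Defensive.

Local Open Scope classical_set_scope.
Local Open Scope group_scope.

(* Subgroups and quotients of a possibly infinite group: [fingroup] only
   treats finite groups. *)

Section InfiniteGroups.
Variable gT : groupType.
Implicit Types (x y g : gT) (A B G N : set gT).

Definition subgroup G := G 1 /\ forall x y, G x -> G y -> G (x * y^-1).

Definition subgroup_generated A : set gT := smallest subgroup A.

Definition normal_in N G :=
  [/\ subgroup G, subgroup N, N `<=` G &
      forall g n, G g -> N n -> N (n ^ g)].

Definition left_coset g N : set gT := [set g * n | n in N].

Definition mul_set A B : set gT := [set x * y | x in A & y in B].

Definition inv_set A : set gT := [set x^-1 | x in A].

Lemma subgroup1 G : subgroup G -> G 1.
Proof. by case. Qed.

Lemma subgroupV G x : subgroup G -> G x -> G x^-1.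
Proof. by move=> [G1 GB] Gx; rewrite -[x^-1]mul1g; apply: GB. Qed.

Lemma subgroupM G x y : subgroup G -> G x -> G y -> G (x * y).
Proof.
move=> sG Gx Gy; rewrite -[y]invgK; case: sG (subgroupV sG Gy) => _ GB Gy'.
exact: GB.
Qed.

Lemma generated_subgroup A : subgroup (subgroup_generated A).
Proof.
split=> [H [[H1 _] _] //|x y Ax Ay H [sH AH]].
by case: (sH) => _; apply; [apply: Ax | apply: Ay].
Qed.

Lemma sub_generated A : A `<=` subgroup_generated A.
Proof. by move=> x Ax H [_]; apply. Qed.

Lemma generated_min A G : subgroup G -> A `<=` G -> subgroup_generated A `<=` G.
Proof. by move=> sG AG x; apply. Qed.

Lemma generated_normal A G : subgroup G -> A `<=` G ->
  (forall g n, G g -> A n -> A (n ^ g)) -> normal_in (subgroup_generated A) G.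
Proof.
move=> sG AG nA; have sA := generated_subgroup A.
split=> //; first exact: generated_min.
move=> g n Gg; suff: subgroup_generated A `<=` [set n | subgroup_generated A (n ^ g)] by apply.
apply: generated_min => [|m Am]; last by apply: sub_generated; apply: nA.
split=> /= [|x y Ax Ay]; first by rewrite conj1g; exact: subgroup1.
by rewrite conjMg conjVg; case: sA => _; apply.
Qed.

Lemma left_coset1 N : left_coset 1 N = N.
Proof.
apply/seteqP; split=> [_ [n Nn <-]|n Nn]; first by rewrite mul1g.
by exists n; rewrite ?mul1g.
Qed.

Section CosetProduct.
Variables (G N : set gT).
Hypothesis nNG : normal_in N G.

Lemma mul_left_coset g h : G g -> G h ->
  mul_set (left_coset g N) (left_coset h N) = left_coset (g * h) N.
Proof.
case: nNG => sG sN NG nN Gg Gh; apply/seteqP; split=> [z|_ [n Nn <-]].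
  case=> _ [m Nm <-] [_ [n Nn <-]] <-.
  exists (m ^ h * n); first by apply: subgroupM => //; apply: nN.
  by rewrite /conjg !mulgA mulgK.
exists g; first by exists 1; [exact: subgroup1|rewrite mulg1].
by exists (h * n); [exists n|rewrite mulgA].
Qed.

Lemma inv_left_coset g : G g -> inv_set (left_coset g N) = left_coset g^-1 N.
Proof.
case: nNG => sG sN NG nN Gg; apply/seteqP; split=> [z|_ [n Nn <-]].
  case=> _ [n Nn <-] <-; exists (n^-1 ^ g^-1).
    by apply: nN; [exact: subgroupV|exact: subgroupV].
  by rewrite invgM /conjg invgK mulgA mulVg mul1g.
exists (n^-1 * g); last by rewrite invgM invgK.
exists (n^-1 ^ g); last by rewrite /conjg mulgA mulgV mul1g.
by apply: nN => //; exact: subgroupV.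
Qed.

End CosetProduct.

(* The proof of normality is a parameter of the type so that the quotient
   can carry a canonical group structure. *)
Record quot_group G N (nNG : normal_in N G) : Type := Coset {
  coset_set : set gT;
  coset_setP : exists2 g, G g & coset_set = left_coset g N
}.

End InfiniteGroups.

Section QuotientGroup.
Variables (gT : groupType) (G N : set gT) (nNG : normal_in N G).
Local Notation Q := (quot_group nNG).
Implicit Types A B C : Q.

HB.instance Definition _ := gen_eqMixin Q.
HB.instance Definition _ := gen_choiceMixin Q.

Lemma coset_set_inj : injective (@coset_set gT G N nNG).
Proof.
by move=> [A pA] [B pB] /= eAB; case: B / eAB pB => pB; congr Coset; exact: Prop_irrelevance.
Qed.

Lemma quotient_mulP A B : exists2 g, G g &
  mul_set (coset_set A) (coset_set B) = left_coset g N.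
Proof.
have [g Gg ->] := coset_setP A; have [h Gh ->] := coset_setP B; exists (g * h).
  by apply: subgroupM => //; case: nNG.
exact: (mul_left_coset nNG).
Qed.

Lemma quotient_invP A : exists2 g, G g &
  inv_set (coset_set A) = left_coset g N.
Proof.
have [g Gg ->] := coset_setP A; exists g^-1; first by apply: subgroupV => //; case: nNG.
exact: (inv_left_coset nNG).
Qed.

Lemma quotient_oneP : exists2 g, G g & N = left_coset g N.
Proof. by exists 1; [case: nNG => -[]|rewrite left_coset1]. Qed.

Definition quotient_mul A B : Q := Coset nNG (quotient_mulP A B).
Definition quotient_inv A : Q := Coset nNG (quotient_invP A).
Definition quotient_one : Q := Coset nNG quotient_oneP.

Lemma quotient_mulA : associative quotient_mul.
Proof.
move=> A B C; apply: coset_set_inj => /=; apply/seteqP; split=> z /=.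
  case=> a Aa [_ [b Bb [c Cc <-]] <-]; exists (a * b); last first.
    by exists c; rewrite ?mulgA.
  by exists a => //; exists b.
case=> _ [a Aa [b Bb <-]] [c Cc <-]; exists a => //.
by exists (b * c); [exists b => //; exists c|rewrite mulgA].
Qed.

Lemma quotient_mul1 : left_id quotient_one quotient_mul.
Proof.
move=> A; apply: coset_set_inj => /=; have [g Gg ->] := coset_setP A.
have [sG _ _ _] := nNG; have G1 := subgroup1 sG.
by rewrite -[N in mul_set N]left_coset1 (mul_left_coset nNG)// mul1g.
Qed.

Lemma quotient_mulr1 : right_id quotient_one quotient_mul.
Proof.
move=> A; apply: coset_set_inj => /=; have [g Gg ->] := coset_setP A.
have [sG _ _ _] := nNG; have G1 := subgroup1 sG.
by rewrite -[N in mul_set _ N]left_coset1 (mul_left_coset nNG)// mulg1.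
Qed.

Lemma quotient_mulV : left_inverse quotient_one quotient_inv quotient_mul.
Proof.
move=> A; apply: coset_set_inj => /=; have [g Gg ->] := coset_setP A.
have [sG _ _ _] := nNG; have G1 := subgroup1 sG.
have GV := subgroupV sG Gg.
by rewrite (inv_left_coset nNG)// (mul_left_coset nNG)// mulVg left_coset1.
Qed.

Lemma quotient_mulrV : right_inverse quotient_one quotient_inv quotient_mul.
Proof.
move=> A; apply: coset_set_inj => /=; have [g Gg ->] := coset_setP A.
have [sG _ _ _] := nNG; have G1 := subgroup1 sG.
have GV := subgroupV sG Gg.
by rewrite (inv_left_coset nNG)// (mul_left_coset nNG)// mulgV left_coset1.
Qed.

HB.instance Definition _ := isGroup.Build Q quotient_mulA
  quotient_mul1 quotient_mulr1 quotient_mulV quotient_mulrV.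

End QuotientGroup.

Definition isomorphic (gT hT : groupType) : Prop :=
  exists f : gT -> hT, bijective f /\ {morph f : x y / x * y}.

Section TreeAutomorphisms.
Variable d : nat.
Local Notation word := (seq 'I_d).
Implicit Types (u v w : word) (x : 'I_d).

Definition adjacent : rel word := fun u v =>
  [exists x, v == rcons u x] || [exists x, u == rcons v x].

Record aut : Type := Aut {
  aut_fun :> word -> word;
  aut_bij : bijective aut_fun;
  aut_root : aut_fun [::] = [::];
  aut_adj : {mono aut_fun : u v / adjacent u v}
}.

HB.instance Definition _ := gen_eqMixin aut.
HB.instance Definition _ := gen_choiceMixin aut.

Lemma autP (g h : aut) : g =1 h -> g = h.
Proof.
case: g h => [g bg rg ag] [h bh rh ah] /= /funext egh.
by case: h / egh bh rh ah => *; congr Aut; exact: Prop_irrelevance.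
Qed.

Definition aut_one : aut := @Aut id (Bijective (frefl id) (frefl id)) erefl (fun _ _ => erefl).

(* [g * h] is [g] followed by [h]. *)
Lemma aut_mul_adj (g h : aut) : {mono h \o g : u v / adjacent u v}.
Proof. by move=> u v /=; rewrite !aut_adj. Qed.
Lemma aut_mul_root (g h : aut) : (h \o g) [::] = [::].
Proof. by rewrite /= !aut_root. Qed.
Definition aut_mul (g h : aut) : aut :=
  Aut (bij_comp (aut_bij h) (aut_bij g)) (aut_mul_root g h) (aut_mul_adj g h).

Lemma aut_inv_subproof (g : aut) : exists h : aut, cancel g h /\ cancel h g.
Proof.
case: (aut_bij g) => h gK hK.
have rh : h [::] = [::] by rewrite -{1}(aut_root g) gK.
have ah : {mono h : u v / adjacent u v} by move=> u v; rewrite -(aut_adj g) !hK.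
exists (Aut (Bijective hK gK) rh ah); split=> u /=; [exact: gK|exact: hK].
Qed.
Definition aut_inv (g : aut) : aut := projT1 (cid (aut_inv_subproof g)).
Lemma aut_invK (g : aut) : cancel g (aut_inv g).
Proof. by case: (projT2 (cid (aut_inv_subproof g))). Qed.
Lemma autVK (g : aut) : cancel (aut_inv g) g.
Proof. by case: (projT2 (cid (aut_inv_subproof g))). Qed.

Lemma aut_mulA : associative aut_mul. Proof. by move=> *; exact: autP. Qed.
Lemma aut_mul1 : left_id aut_one aut_mul. Proof. by move=> ?; exact: autP. Qed.
Lemma aut_mulr1 : right_id aut_one aut_mul. Proof. by move=> ?; exact: autP. Qed.
Lemma aut_mulV : left_inverse aut_one aut_inv aut_mul.
Proof. by move=> g; apply: autP => u /=; rewrite autVK. Qed.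
Lemma aut_mulrV : right_inverse aut_one aut_inv aut_mul.
Proof. by move=> g; apply: autP => u /=; rewrite aut_invK. Qed.

HB.instance Definition _ := isGroup.Build aut
  aut_mulA aut_mul1 aut_mulr1 aut_mulV aut_mulrV.

Lemma aut1E u : (1 : aut) u = u. Proof. by []. Qed.
Lemma autM (g h : aut) u : (g * h) u = h (g u). Proof. by []. Qed.
Lemma autK (g : aut) : cancel g (g^-1)%g. Proof. exact: aut_invK. Qed.
Lemma autKV (g : aut) : cancel (g^-1)%g g. Proof. exact: autVK. Qed.

Lemma adjacent_rcons u x : adjacent (rcons u x) u.
Proof. by apply/orP; right; apply/existsP; exists x. Qed.

Lemma aut_rcons (g : aut) u x : exists y, g (rcons u x) = rcons (g u) y.
Proof.
elim/last_ind: u x => [|u z IH] x.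
  have := adjacent_rcons [::] x; rewrite -(aut_adj g) aut_root.
  case/orP=> /existsP[y /eqP]; last by exists y.
  by case: (g _).
have := adjacent_rcons (rcons u z) x; rewrite -(aut_adj g).
case/orP=> /existsP[y /eqP e]; last by exists y.
have [t et] := IH z; move: e; rewrite et => /rcons_inj[/(bij_inj (aut_bij g)) e _].
by move/(congr1 size)/eqP: e; rewrite !size_rcons eqn_leq ltnNge leqnSn andbF.
Qed.

Lemma size_aut (g : aut) u : size (g u) = size u.
Proof.
elim/last_ind: u => [|u x IH]; first by rewrite aut_root.
by have [y ->] := aut_rcons g u x; rewrite !size_rcons IH.
Qed.

Lemma prefix_aut (g : aut) u v : prefix (g u) (g v) = prefix u v.
Proof.
have pre (h : aut) w : forall v', prefix w v' -> prefix (h w) (h v').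
  move=> _ /prefixP[t ->]; elim/last_ind: t => [|t x IH]; first by rewrite cats0 prefix_refl.
  have [y] := aut_rcons h (w ++ t) x.
  by rewrite -rcons_cat => ->; apply: (prefix_trans IH); exact: prefix_rcons.
apply/idP/idP; last exact: pre.
by move/(pre g^-1); rewrite !autK.
Qed.

(* Letters and generators are numbered from 0: the letter x in {1, ..., d} is the
   ordinal [x - 1]. The successor [ordS] is cyclic, so the clauses below, which
   are the wreath recursion of [a_i] read off on words, also cover [a_d]. *)
Fixpoint gen_fun (i : 'I_d) w {struct w} : word :=
  if w is x :: w' then
    if x == i then ordS i :: gen_fun i w'
    else if x == ordS i then i :: gen_fun (ordS i) w'
    else x :: w'
  else [::].

Fixpoint gen_inv (i : 'I_d) w {struct w} : word :=
  if w is x :: w' then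
    if x == ordS i then i :: gen_inv i w'
    else if x == i then ordS i :: gen_inv (ordS i) w'
    else x :: w'
  else [::].

Lemma gen_funK i : cancel (gen_fun i) (gen_inv i).
Proof.
move=> w; elim: w i => [//|x w IH] i /=.
have [->|xi] := eqVneq x i; first by rewrite /= eqxx IH.
have [e|xS] := eqVneq x (ordS i); last by rewrite /= (negPf xi) (negPf xS).
by rewrite /= -e eq_sym (negPf xi) eqxx e IH.
Qed.

Lemma gen_invK i : cancel (gen_inv i) (gen_fun i).
Proof.
move=> w; elim: w i => [//|x w IH] i /=.
have [->|xS] := eqVneq x (ordS i); first by rewrite /= eqxx IH.
have [e|xi] := eqVneq x i; last by rewrite /= (negPf xi) (negPf xS).
by rewrite -e in xS *; rewrite /= eq_sym (negPf xS) eqxx IH.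
Qed.

Lemma gen_fun_rcons i u x : exists y, gen_fun i (rcons u x) = rcons (gen_fun i u) y.
Proof.
elim: u i => [|z u IH] i /=; first by do 2?case: ifP => _; eexists.
do 2?case: ifP => _; last by exists x.
- by have [y ->] := IH i; exists y.
- by have [y ->] := IH (ordS i); exists y.
Qed.

Lemma gen_inv_rcons i u x : exists y, gen_inv i (rcons u x) = rcons (gen_inv i u) y.
Proof.
elim: u i => [|z u IH] i /=; first by do 2?case: ifP => _; eexists.
do 2?case: ifP => _; last by exists x.
- by have [y ->] := IH i; exists y.
- by have [y ->] := IH (ordS i); exists y.
Qed.

Lemma gen_adj i : {mono gen_fun i : u v / adjacent u v}.
Proof.
have imp (f : word -> word) : (forall u x, exists y, f (rcons u x) = rcons (f u) y) ->
    forall u v, adjacent u v -> adjacent (f u) (f v).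
  move=> fr u v /orP[]/existsP[x /eqP->]; apply/orP.
    by left; apply/existsP; have [y ->] := fr u x; exists y.
  by right; apply/existsP; have [y ->] := fr v x; exists y.
move=> u v; apply/idP/idP; last exact: (imp _ (gen_fun_rcons i)).
by move/(imp _ (gen_inv_rcons i)); rewrite !gen_funK.
Qed.

Definition gen (i : 'I_d) : aut :=
  @Aut (gen_fun i) (Bijective (gen_funK i) (gen_invK i)) erefl (gen_adj i).

Lemma gen_self i w : gen i (i :: w) = ordS i :: gen i w.
Proof. by rewrite /= eqxx. Qed.

Lemma gen_next i w : 1 < d -> gen i (ordS i :: w) = i :: gen (ordS i) w.
Proof.
move=> d1; rewrite /= eqxx; suff /negPf-> : ordS i != i by [].
apply/eqP => /(congr1 val) /= e; have := ltn_ord i; rewrite leq_eqVlt.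
case/orP=> [/eqP id|id]; last by move: e; rewrite modn_small// => /eqP; rewrite gtn_eqF.
by move: e; rewrite id modnn => i0; rewrite -i0 in id; rewrite -id in d1.
Qed.

Lemma gen_other i x w : x != i -> x != ordS i -> gen i (x :: w) = x :: w.
Proof. by move=> /= /negPf-> /negPf->. Qed.

Definition Gd : set aut := subgroup_generated (range gen).

Definition St (k : nat) : set aut :=
  [set g | Gd g /\ forall u, size u = k -> g u = u].

Definition Rist_vertex u : set aut :=
  [set g | Gd g /\ forall w, ~~ prefix u w -> g w = w].

Definition Rist (k : nat) : set aut :=
  subgroup_generated (\bigcup_(u in [set u | size u = k]) Rist_vertex u).

Lemma St_subgroup k : subgroup (St k).
Proof.
have sG : subgroup Gd := generated_subgroup _.
split=> [|g h [Gg fg] [Gh fh]]; first by split=> //; exact: subgroup1.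
split=> [|u uk]; first exact: (proj2 sG).
by rewrite autM fg// -{1}(fh u uk) autK.
Qed.

Lemma Rist_normal k : normal_in (Rist k) (St k).
Proof.
have sG : subgroup Gd := generated_subgroup _.
apply: generated_normal => [|g [u /= uk [Gg fg]]|g n [Gg fg] [u /= uk [Gn fn]]].
- exact: St_subgroup.
- split=> // w wk; have [puw|] := boolP (prefix u w); last exact: fg.
  have pre_eq v : prefix u v -> size v = k -> v = u.
    by move=> /prefixP[t ->]; rewrite size_cat uk -[RHS]addn0 => /eqP; rewrite eqn_add2l => /nilP->; rewrite cats0.
  rewrite (pre_eq w)//; have [pug|/fg] := boolP (prefix u (g u)).
    by rewrite (pre_eq (g u))// size_aut.
  exact: bij_inj (aut_bij g) _ _.
- exists u => //; split=> [|w uw].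
    by apply: (subgroupM sG); [exact: (subgroupV sG)|exact: (subgroupM sG)].
  rewrite /conjg !autM fn ?autKV//; rewrite -(prefix_aut g) autKV.
  by rewrite (fg u uk).
Qed.

End TreeAutomorphisms.

Local Close Scope group_scope.

(* The exponent [s] in [i = d ^ s * r] with [d] not dividing [r]; since [d]
   need not be prime, [logn] does not apply. *)
Definition dval (d i : nat) : nat := \max_(s < i.+1 | d ^ s %| i) s.

Lemma dvalE d s r : 1 < d -> ~~ (d %| r) -> dval d (d ^ s * r) = s.
Proof.
move=> d1 dr; have r0 : 0 < r by case: r dr => //; rewrite dvdn0.
have ds0 j : 0 < d ^ j by rewrite expn_gt0 ltnW.
have lt : s < (d ^ s * r).+1.
  by rewrite ltnS (leq_trans (ltnW (ltn_expl s d1)))// leq_pmulr.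
apply/eqP; rewrite eqn_leq; apply/andP; split.
  apply/bigmax_leqP => j; rewrite leqNgt => dj; apply/negP => sj.
  move: dj; rewrite -(subnKC sj) expnD expnSr -mulnA dvdn_pmul2l// => dj.
  by move/negP: dr; apply; exact: dvdn_trans (dvdn_mulr _ (dvdnn d)) dj.
by apply: (bigmax_sup (Ordinal lt)) => //=; exact: dvdn_mulr.
Qed.

Definition alpha (d k i : nat) : nat :=
  if d %| i then 2 ^ (k - dval d i) else 2 ^ k.+1.

(* ['Z_n] is the cyclic group of order [n] only for [n > 1]. *)
Lemma alpha_gt1 d k i : 1 < d -> 0 < i < d ^ k -> 1 < alpha d k i.
Proof.
move=> d1 /andP[i0 idk]; rewrite /alpha; case: ifP => _; last first.
  by rewrite -[1%N](expn0 2) ltn_exp2l.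
rewrite -[1%N](expn0 2) ltn_exp2l// subn_gt0 /dval.
have k0 : 0 < k by case: k idk => //; rewrite expn0 ltnS leqNgt i0.
rewrite -(prednK k0) ltnS; apply/bigmax_leqP => s dsi.
rewrite -ltnS prednK// -(ltn_exp2l _ _ d1); exact: leq_ltn_trans (dvdn_leq i0 dsi) idk.
Qed.

Definition cyclic_product (d k : nat) : finGroupType :=
  {dffun forall i : 'I_(d ^ k).-1, 'Z_(alpha d k i.+1)}.

(* Main.v *)
Require Import Defs.
From mathcomp Require Import all_boot all_order all_algebra all_fingroup.
From mathcomp Require Import boolp classical_sets functions cardinality.
From mathcomp Require Import zify ring.
Import Defs.
Import GRing.Theory.

(** The group is understood through one homomorphism, the exponent sum of a word
    in the generators. It is well defined on the group ([expsum_relator]), and the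
    elements of exponent sum 0 can be placed below any single vertex by an
    element of the group acting trivially elsewhere ([placeable_expsum0]): the defect of
    a braid relation between neighbouring generators is such an element, and modulo
    its conjugates all generators agree, because [d] is odd. Hence
    an element of the stabilizer of level [k] is determined, modulo
    elements of the rigid stabilizer, by the vector of exponent sums of its
    sections at the leaves, that is, at the vertices of level [k].

    Which vectors occur? A generator has two nontrivial sections on the first
    level, of its own sign, so passing to the first level doubles the total
    exponent sum; an element fixing the first level is an even permutation
    there and has even exponent sum. The vectors attained on the first level are
    exactly those of sum divisible by 4 ([attained_sum4]): the squares of the
    generators give twice the sum of two unit vectors, and the generator closing the
    cycle, compared with the conjugate of a generator by the others that induces the same
    transposition, yields a difference of two unit vectors. By recursion, the
    vectors attained at level [k] are those whose sum over the [d^s] leaves below any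
    vertex is divisible by [2^(s+1)], for each [0 < s <= k] ([balanced_vsec],
    [balanced_realized]). A vector supported at a single leaf is attained when its entry
    is divisible by [2^(k+1)], so the quotient is the group of these vectors modulo
    [2^(k+1)] ([Rist_divisible], [divisible_Rist]).

    Finally, the sums over the blocks of leaves below the vertices that
    are not leftmost among their siblings, together with the total sum, are coordinates on
    the leaf vectors ([blocksum_prescribed]). The index [i = d^s r], with [d] not dividing
    [r], numbers the block of the [d^s] leaves starting at the [i]-th one; its sum
    is a multiple of [2^(s+1)] modulo [2^(k+1)] if [s > 0], and arbitrary if
    [s = 0]; this is the cyclic factor of order [alpha d k i]. The total sum
    contributes nothing, being divisible by [2^(k+1)]. *)

Set Implicit Arguments.
Unset Strict Implicit.
Unset Printing Implicit Defensive.

Local Open Scope group_scope.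

(** * Signed words and their sections *)

Section Words.
Variable d : nat.
Local Notation vertex := (seq 'I_d).
Local Notation letter := ('I_d * bool)%type.
Local Notation word := (seq letter).
Implicit Types (x y i j : 'I_d) (u t p : vertex) (l : letter) (w : word).

Definition lact l : 'S_d := tperm l.1 (ordS l.1).

Definition act w : 'S_d := \prod_(l <- w) lact l.

Definition moves l x := (x == l.1) || (x == ordS l.1).

(** A positive letter leaves a generator indexed by the vertex of departure, an inverse
    one by the vertex of arrival, as the section of an inverse at a vertex is the inverse of
    the section at its image. *)
Definition lsec x l : word :=
  if moves l x then [:: (if l.2 then x else lact l x, l.2)] else [::].

Fixpoint wsec x w : word :=
  if w is l :: w' then lsec x l ++ wsec (lact l x) w' else [::].

Fixpoint vsec u w : word := if u is x :: u' then vsec u' (wsec x w) else w.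

Definition leval l : aut d := if l.2 then gen l.1 else (gen l.1)^-1.

Definition eval w : aut d := \prod_(l <- w) leval l.

Definition sgl l : int := if l.2 then 1%R else (-1)%R.

Definition expsum w : int := (\sum_(l <- w) sgl l)%R.

Definition winv w : word := rev [seq (l.1, ~~ l.2) | l <- w].

Lemma act_nil : act [::] = 1.
Proof. by rewrite /act big_nil. Qed.

Lemma act_cons l w : act (l :: w) = lact l * act w.
Proof. by rewrite /act big_cons. Qed.

Lemma act_cat w1 w2 : act (w1 ++ w2) = act w1 * act w2.
Proof. by rewrite /act big_cat. Qed.

Lemma eval_nil : eval [::] = 1.
Proof. by rewrite /eval big_nil. Qed.

Lemma eval_cons l w : eval (l :: w) = leval l * eval w.
Proof. by rewrite /eval big_cons. Qed.

Lemma eval_cat w1 w2 : eval (w1 ++ w2) = eval w1 * eval w2.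
Proof. by rewrite /eval big_cat. Qed.

Lemma expsum_nil : expsum [::] = 0%R.
Proof. by rewrite /expsum big_nil. Qed.

Lemma expsum_cons l w : expsum (l :: w) = (sgl l + expsum w)%R.
Proof. by rewrite /expsum big_cons. Qed.

Lemma expsum_cat w1 w2 : expsum (w1 ++ w2) = (expsum w1 + expsum w2)%R.
Proof. by rewrite /expsum big_cat. Qed.

Lemma eval_winv w : eval (winv w) = (eval w)^-1.
Proof.
elim: w => [|[i b] w IH]; first by rewrite /winv /= eval_nil invg1.
rewrite /winv /= rev_cons -cats1 eval_cat IH !eval_cons eval_nil mulg1 invgM.
by congr (_ * _); case: b; rewrite /leval ?invgK.
Qed.

Lemma expsum_winv w : expsum (winv w) = (- expsum w)%R.
Proof.
elim: w => [|[i b] w IH]; first by rewrite /winv /= expsum_nil oppr0.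
rewrite /winv /= rev_cons -cats1 expsum_cat IH !expsum_cons expsum_nil.
by case: b; rewrite /sgl /=; lia.
Qed.

Lemma wsec_cat x w1 w2 : wsec x (w1 ++ w2) = wsec x w1 ++ wsec (act w1 x) w2.
Proof.
elim: w1 x => [|l w1 IH] x /=; first by rewrite act_nil perm1.
by rewrite IH catA act_cons permM.
Qed.

Lemma vsec_cat u t w : vsec (u ++ t) w = vsec t (vsec u w).
Proof. by elim: u w => //= x u IH w. Qed.

Lemma moves_lact l x : moves l (lact l x) = moves l x.
Proof.
rewrite /moves /lact.
by case: tpermP => [->|->|/eqP/negPf-> /eqP/negPf->]; rewrite ?eqxx ?orbT.
Qed.

Lemma leval_vertex l x u : leval l (x :: u) = lact l x :: eval (lsec x l) u.
Proof.
case: l => i [] /=; rewrite /leval /lsec /lact /moves /=.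
  case: tpermP => [->|->|/eqP/negPf xi /eqP/negPf xS].
  - by rewrite !eqxx /= eval_cons eval_nil mulg1.
  - rewrite eqxx orbT /= eval_cons eval_nil mulg1 /leval /=.
    by case: eqP => [->|].
  - by rewrite xi xS /= eval_nil.
apply: (bij_inj (aut_bij (gen i))); rewrite autKV /=.
case: tpermP => [->|->|/eqP/negPf xi /eqP/negPf xS].
- rewrite !eqxx /= eval_cons eval_nil mulg1 /leval /=.
  by case: eqP => [e|_]; rewrite -[gen_fun _ _]/(gen _ _) ?e autKV.
- rewrite !eqxx orbT /= eval_cons eval_nil mulg1 /leval /=.
  by rewrite -[gen_fun _ _]/(gen _ _) autKV.
- by rewrite xi xS /= eval_nil.
Qed.

Lemma eval_vertex w x u : eval w (x :: u) = act w x :: eval (wsec x w) u.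
Proof.
elim: w x u => [|l w IH] x u; first by rewrite act_nil eval_nil perm1.
by rewrite eval_cons act_cons permM autM leval_vertex IH /= eval_cat autM.
Qed.

Lemma eval_vertex_cat w u t : eval w (u ++ t) = eval w u ++ eval (vsec u w) t.
Proof.
elim: u w => [|x u IH] w; first by rewrite aut_root.
by rewrite /= !eval_vertex /= IH.
Qed.

Lemma eval_vsec w w' u : eval w = eval w' -> eval (vsec u w) = eval (vsec u w').
Proof.
move=> e; apply: autP => t; have := eval_vertex_cat w u t.
rewrite e eval_vertex_cat => /eqP; rewrite eqseq_cat //.
by case/andP=> _ /eqP.
Qed.

Lemma vsec_cat_word u w1 w2 :
  vsec u (w1 ++ w2) = vsec u w1 ++ vsec (eval w1 u) w2.
Proof.
elim: u w1 w2 => [|x u IH] w1 w2; first by rewrite aut_root.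
by rewrite eval_vertex /= wsec_cat IH.
Qed.

Lemma vsec_eval1 w u : eval w = 1 -> eval (vsec u w) = 1.
Proof.
move=> w1; rewrite (@eval_vsec w [::]) ?eval_nil //.
by elim: u => [|x u IH] //=; rewrite eval_nil.
Qed.

Lemma act_eval1 w : eval w = 1 -> act w = 1.
Proof. by move=> w1; apply/permP => x; have := eval_vertex w x [::]; rewrite w1 perm1 => -[]. Qed.

Lemma size_lsec x l : size (lsec x l) <= 1.
Proof. by rewrite /lsec; case: ifP. Qed.

Lemma size_wsec x w : size (wsec x w) <= size w.
Proof.
elim: w x => //= l w IH x; rewrite size_cat -add1n leq_add ?size_lsec //.
Qed.

Lemma Gd_leval l : Gd (leval l).
Proof.
have sG : subgroup (@Gd d) := generated_subgroup _.
have Gg i : Gd (gen i) by apply: sub_generated; exists i.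
by case: l => i []; [exact: Gg | exact: (subgroupV sG (Gg i))].
Qed.

Lemma Gd_eval w : Gd (eval w).
Proof.
have sG : subgroup (@Gd d) := generated_subgroup _.
elim: w => [|l w IH]; first by rewrite eval_nil; exact: subgroup1.
by rewrite eval_cons; exact: (subgroupM sG (Gd_leval l) IH).
Qed.

Lemma Gd_word g : Gd g -> exists w, g = eval w.
Proof.
suff: (@Gd d `<=` [set g | exists w, g = eval w])%classic by apply.
apply: generated_min => [|_ [i _ <-]]; last first.
  by exists [:: (i, true)]; rewrite eval_cons eval_nil mulg1.
split; first by exists [::]; rewrite eval_nil.
move=> _ _ [w ->] [w' ->]; exists (w ++ winv w').
by rewrite eval_cat eval_winv.
Qed.

(** Parity: every generator acts on the first level as a transposition. *)
Lemma odd_act w : 1 < d -> odd_perm (act w) = odd (size w).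
Proof.
move=> d1; have iS i : i != ordS i.
  apply/eqP => /(congr1 val) /= e; have := ltn_ord i; rewrite leq_eqVlt.
  case/orP=> [/eqP id|id]; last by move: e; rewrite modn_small //; lia.
  by move: e; rewrite id modnn; lia.
elim: w => [|l w IH]; first by rewrite act_nil odd_perm1.
by rewrite act_cons odd_mul_tperm iS IH /= .
Qed.

End Words.

(** * The exponent sum is a function of the automorphism *)

Section ExponentSum.
Variable d : nat.
Hypothesis hd : 3 <= d.
Local Notation vertex := (seq 'I_d).
Local Notation letter := ('I_d * bool)%type.
Local Notation word := (seq letter).
Implicit Types (x y i j : 'I_d) (u t p : vertex) (l : letter) (w : word).

Lemma ordS_neq i : ordS i != i.
Proof.
apply/eqP => /(congr1 val) /= e; have := ltn_ord i; rewrite leq_eqVlt.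
case/orP=> [/eqP id|id]; last by move: e; rewrite modn_small //; lia.
by move: e; rewrite id modnn; lia.
Qed.

Lemma ordSS_neq i : ordS (ordS i) != i.
Proof.
apply/eqP => /(congr1 val) /= e; have := ltn_ord i.
rewrite -[(i.+1 %% d).+1]addn1 modnDml addn1 in e.
have [lt _|ge lti] := ltnP i.+2 d; first by move: e; rewrite modn_small; lia.
move: e; have -> : i.+2 = (d + (i.+2 - d))%N by lia.
by rewrite modnDl modn_small; lia.
Qed.

Lemma moves_self l : moves l l.1.
Proof. by rewrite /moves eqxx. Qed.

Lemma moves_next l : moves l (ordS l.1).
Proof. by rewrite /moves eqxx orbT. Qed.

Lemma sum_moves l (c : int) :
  (\sum_x (if moves l x then c else 0) = c + c)%R.
Proof.
rewrite (bigD1 l.1) //= moves_self (bigD1 (ordS l.1)) ?ordS_neq //= moves_next.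
rewrite big1 ?addr0 // => x /andP[x1 x2].
by rewrite /moves (negPf x1) (negPf x2).
Qed.

(** Each letter moves exactly two letters of the alphabet and leaves one
    section letter of its own sign at both. *)
Lemma sum_wsec w : (\sum_x expsum (wsec x w) = expsum w + expsum w)%R.
Proof.
elim: w => [|l w IH].
  by rewrite expsum_nil addr0 big1.
rewrite (eq_bigr (fun x => (if moves l x then sgl l else 0) +
    expsum (wsec (lact l x) w))%R); last first.
  move=> x _; rewrite /= expsum_cat /lsec; case: ifP => _; rewrite ?expsum_nil //.
  by rewrite expsum_cons expsum_nil addr0.
rewrite big_split /= sum_moves expsum_cons.
have -> : (\sum_x expsum (wsec (lact l x) w) = expsum w + expsum w)%R.
  by rewrite -IH [RHS](reindex_inj (@perm_inj _ (lact l))).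
by rewrite addrACA.
Qed.

Lemma expsum_even w : ~~ odd (size w) -> exists m : int, expsum w = (m + m)%R.
Proof.
have gen w' : exists m : int, expsum w' = (m + m + (odd (size w'))%:Z)%R.
  elim: w' => [|l w' [m IH]]; first by exists 0%R; rewrite expsum_nil.
  rewrite expsum_cons IH /sgl /=; case: l.2; case: (odd _) => /=.
  - by exists (m + 1)%R; lia.
  - by exists m; lia.
  - by exists m; lia.
  - by exists (m - 1)%R; lia.
by move=> ev; have [m ->] := gen w; exists m; rewrite (negPf ev) addr0.
Qed.

Lemma expsum_even_act w : act w = 1 -> exists m : int, expsum w = (m + m)%R.
Proof.
move=> w1; apply: expsum_even; rewrite -odd_act ?w1 ?odd_perm1 //; lia.
Qed.

Lemma abs_expsum w : `|expsum w|%N <= size w.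
Proof.
elim: w => [|l w IH]; first by rewrite expsum_nil.
rewrite expsum_cons /sgl /=; move: IH; case: l.2; lia.
Qed.

Definition full x w := size (wsec x w) == size w.

Lemma full_cons x l w : full x (l :: w) = moves l x && full (lact l x) w.
Proof.
rewrite /full /= size_cat /lsec; case: ifP => [m|_] /=; first by rewrite add1n eqSS.
by apply: ltn_eqF; rewrite ltnS add0n size_wsec.
Qed.

(** Two positions that every letter of [w] moves swap at each letter, so that
    letter is always the same. *)
Lemma full_two i w : full i w -> full (ordS i) w -> all (fun l => l.1 == i) w.
Proof.
elim: w => //= l w IH; rewrite !full_cons => /andP[m1 f1] /andP[m2 f2].
have e : l.1 = i.
  move: m1 m2; rewrite /moves => /orP[/eqP -> //|/eqP e].
  rewrite e (inj_eq (can_inj (@ordSK d))) => /orP[|].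
    by rewrite (negPf (ordSS_neq _)).
  by rewrite (negPf (ordS_neq _)).
rewrite e eqxx /=; apply: IH.
  by move: f2; rewrite /lact e tpermR.
by move: f1; rewrite /lact e tpermL.
Qed.

(** A power of a single generator whose section uses a single letter has
    alternating signs. *)
Lemma expsum_alternate i j x w : all (fun l => l.1 == i) w ->
  moves (i, true) x -> all (fun l => l.1 == j) (wsec x w) ->
  expsum w = 0%R \/ expsum w = (if x == j then 1 else -1)%R.
Proof.
elim: w x => [|l w IH] x; first by left; rewrite expsum_nil.
case: l => _ b /= /andP[/eqP-> aw] mx; rewrite all_cat /lsec.
rewrite [moves _ _]mx /= andbT => /andP[/eqP ej as'].
have mx' : moves (i, true) (lact (i, b) x).
  exact: etrans (moves_lact (i, b) x) mx.
have xx : lact (i, b) x != x.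
  move: mx; rewrite /lact /moves /=; case: tpermP => [-> _|-> _|/eqP/negPf-> /eqP/negPf-> //].
    exact: ordS_neq.
  by rewrite eq_sym ordS_neq.
have := IH _ aw mx' as'; rewrite expsum_cons /sgl /= {as' mx'}.
move: ej xx; case: b => [->|->] xx.
  by rewrite eqxx (negPf xx); lia.
by rewrite eqxx eq_sym (negPf xx); lia.
Qed.

(** Take a relator of minimal length [n] with nonzero exponent sum. Its sections are
    relators no longer than itself, their exponent sums add up to twice its own, and only
    those of length [n] can be nonzero; at most two are. So the absolute
    value of the exponent sum grows on passing to some section, unless two sections have
    length [n] and the same exponent sum as the relator. In that case the relator is a
    word in a single generator and the step can be repeated on one
    of the sections, which is not such a word unless the signs of the
    relator alternate, when its even exponent sum is 0. Hence there are relators of length [n] with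
    arbitrarily large exponent sum, which is absurd. *)
Lemma expsum_relator w : eval w = 1 -> expsum w = 0%R.
Proof.
have [n le] := ubnP (size w); elim: n w le => // n IHn w0 le0 w01.
have [//|nz0] := eqVneq (expsum w0) 0%R; exfalso.
have two_n w : size w < n.+1 -> eval w = 1 -> expsum w != 0%R -> size w = n.
  move=> lw w1 nz; apply/eqP; rewrite eqn_leq -ltnS lw /= leqNgt.
  by apply/negP => lt; move: nz; rewrite IHn ?eqxx.
have sec0 x w : size w = n -> eval w = 1 -> ~~ full x w -> expsum (wsec x w) = 0%R.
  move=> sw w1 nf; apply: IHn; last exact: (@vsec_eval1 _ w [:: x]).
  by rewrite -sw ltn_neqAle nf size_wsec.
have even w : eval w = 1 -> exists m : int, expsum w = (m + m)%R.
  by move=> w1; apply: expsum_even_act; apply: act_eval1.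
have sec_size x w : size w = n -> size (wsec x w) < n.+1.
  by move=> sw; rewrite ltnS -sw size_wsec.
have two w : size w = n -> eval w = 1 -> expsum w != 0%R -> exists i,
    (expsum (wsec i w) + expsum (wsec (ordS i) w) = expsum w + expsum w)%R.
  move=> sw w1; case: w sw w1 => [|l w] sw w1 nz; first by rewrite expsum_nil eqxx in nz.
  exists l.1; rewrite -sum_wsec (bigD1 l.1) //= (bigD1 (ordS l.1)) ?ordS_neq //=.
  rewrite big1 ?addr0 // => x /andP[x1 x2]; apply: (sec0 x (l :: w)) => //.
  by rewrite full_cons /moves (negPf x1) (negPf x2).
pose bad w := [/\ size w < n.+1, eval w = 1 & expsum w != 0%R].
(* The section at [i] stays bad when nothing grows, so [one] applies twice. *)
have step w : bad w -> exists2 w', bad w' & (`|expsum w| < `|expsum w'|)%N.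
  move=> [lw w1 nz].
  have one v : bad v -> (exists2 w', bad w' & (`|expsum v| < `|expsum w'|)%N) \/
      exists i, [/\ full i v, full (ordS i) v, expsum (wsec i v) = expsum v
      & expsum (wsec (ordS i) v) = expsum v].
    move=> [lv v1 nzv]; have sv := two_n _ lv v1 nzv.
    have [i ei] := two v sv v1 nzv.
    have badsec x : expsum (wsec x v) != 0%R -> bad (wsec x v).
      by move=> nx; split=> //; [exact: sec_size | exact: (@vsec_eval1 _ v [:: x])].
    have [e1|n1] := eqVneq (expsum (wsec i v)) (expsum v).
      have e2 : expsum (wsec (ordS i) v) = expsum v by lia.
      right; exists i; split=> //.
        by apply: contraT => nf; move: nzv; rewrite -e1 (sec0 i v) ?eqxx.
      by apply: contraT => nf; move: nzv; rewrite -e2 (sec0 (ordS i) v) ?eqxx.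
    left; case: (ltnP `|expsum v| `|expsum (wsec i v)|)%N => lt.
      by exists (wsec i v) => //; apply: badsec; lia.
    by exists (wsec (ordS i) v); [apply: badsec; lia | lia].
  have [//|[i [f1 f2 e1 e2]]] := one w (And3 lw w1 nz).
  have sw := two_n _ lw w1 nz.
  have bad2 : bad (wsec i w).
    by split; [exact: sec_size | exact: (@vsec_eval1 _ w [:: i]) | rewrite e1].
  have [|[j [g1 g2 _ _]]] := one _ bad2; first by rewrite e1.
  have := expsum_alternate (full_two f1 f2) (moves_self _) (full_two g1 g2).
  by have [m em] := even w w1; move: nz; rewrite em; case: ifP => _; lia.
have big m : exists2 w, bad w & m <= `|expsum w|.
  elim: m => [|m [w bw le]]; first by exists w0.
  by have [w' bw' lt] := step w bw; exists w' => //; apply: leq_ltn_trans le lt.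
have [w [lw _ _] le] := big n.+1.
by have := leq_trans le (abs_expsum w); rewrite leqNgt lw.
Qed.

Lemma expsum_eval w w' : eval w = eval w' -> expsum w = expsum w'.
Proof.
move=> e; have := @expsum_relator (w ++ winv w').
rewrite eval_cat eval_winv e mulgV expsum_cat expsum_winv => /(_ erefl) /eqP.
by rewrite subr_eq0 => /eqP.
Qed.

End ExponentSum.

(** * Branching over the elements of exponent sum 0 *)

Section Branching.
Variable d : nat.
Local Notation vertex := (seq 'I_d).
Local Notation letter := ('I_d * bool)%type.
Local Notation word := (seq letter).
Implicit Types (x y z i j m : 'I_d) (u t p : vertex) (l : letter) (w : word).
Implicit Types (g h : aut d) (F : 'I_d -> aut d).

Lemma val_iter_ordS n i : iter n (@ordS d) i = (i + n) %% d :> nat.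
Proof.
elim: n => [|n IH]; first by rewrite addn0 modn_small.
by rewrite iterS /= IH -[X in X %% d]addn1 modnDml addn1 addnS.
Qed.

Lemma ordS_closed (P : 'I_d -> Prop) i j : (forall x, P x -> P (ordS x)) -> P i -> P j.
Proof.
move=> PS Pi; have -> : j = iter (j + d - i) (@ordS d) i.
  apply: ord_inj; rewrite val_iter_ordS.
  have li := ltn_ord i; have lj := ltn_ord j.
  by rewrite subnKC ?modnDr ?modn_small //; lia.
by elim: (_ - _)%N => //= n IH; apply: PS.
Qed.

Hypothesis oddd : odd d.

(** As [d] is odd, the steps of length two also reach every residue. *)
Lemma ordSS_closed (P : 'I_d -> Prop) i j :
  (forall x, P x -> P (ordS (ordS x))) -> P i -> P j.
Proof.
move=> PS; apply: ordS_closed => x Px.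
have -> : ordS x = iter d./2.+1 (fun y => ordS (ordS y)) x.
  have dbl n : iter n (fun y => ordS (ordS y)) x = iter n.*2 (@ordS d) x.
    by elim: n => //= n ->.
  apply: ord_inj; rewrite dbl val_iter_ordS /=.
  have -> : (x + d./2.+1.*2 = x.+1 + d)%N by have := odd_double_half d; rewrite oddd; lia.
  by rewrite modnDr.
by elim: (d./2.+1) => //= n IH; apply: PS.
Qed.

Hypothesis hd : 3 <= d.

Let sG : subgroup (@Gd d) := generated_subgroup _.

Definition realized F := exists2 g, Gd g & forall x t, g (x :: t) = x :: F x t.

Lemma realized_ext F F' : F =1 F' -> realized F -> realized F'.
Proof. by move=> e [g Gg eg]; exists g => // x t; rewrite eg e. Qed.

Lemma realized1 : realized (fun=> 1).
Proof. by exists 1 => //; exact: subgroup1. Qed.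

Lemma realizedM F F' : realized F -> realized F' -> realized (fun x => F x * F' x).
Proof.
move=> [g Gg eg] [g' Gg' eg']; exists (g * g'); first exact: (subgroupM sG).
by move=> x t; rewrite !autM eg eg'.
Qed.

Lemma realizedV F : realized F -> realized (fun x => (F x)^-1).
Proof.
move=> [g Gg eg]; exists g^-1; first exact: (subgroupV sG).
by move=> x t; apply: (bij_inj (aut_bij g)); rewrite autKV eg autKV.
Qed.

Lemma realized_word w : act w = 1 -> realized (fun x => eval (wsec x w)).
Proof.
by move=> w1; exists (eval w); [exact: Gd_eval | move=> x t; rewrite eval_vertex w1 perm1].
Qed.

(** The groupoid of the sections at the first-level vertices. *)
Definition path x y h := exists2 w, act w x = y & eval (wsec x w) = h.

Lemma path_trans x y z h h' : path x y h -> path y z h' -> path x z (h * h').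
Proof.
move=> [w <- <-] [w' <- <-]; exists (w ++ w'); first by rewrite act_cat permM.
by rewrite wsec_cat eval_cat.
Qed.

Lemma path_inv x y h : path x y h -> path y x h^-1.
Proof.
move=> [w <- <-]; have e1 : eval (w ++ winv w) = 1 by rewrite eval_cat eval_winv mulgV.
exists (winv w); first by have := act_eval1 e1; rewrite act_cat => /permP/(_ x); rewrite permM perm1.
have := @vsec_eval1 _ _ [:: x] e1; rewrite /= wsec_cat eval_cat => /mulg1_eq ->.
by [].
Qed.

Lemma path_up j : path j (ordS j) (gen j).
Proof.
exists [:: (j, true)]; first by rewrite act_cons act_nil mulg1 /lact tpermL.
by rewrite /= cats0 /lsec moves_self eval_cons eval_nil mulg1.
Qed.

Lemma path_down j : path (ordS j) j (gen (ordS j)).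
Proof.
exists [:: (j, true)]; first by rewrite act_cons act_nil mulg1 /lact tpermR.
by rewrite /= cats0 /lsec (moves_next (j, true)) eval_cons eval_nil mulg1.
Qed.

(** Self-replication. The loop at [j] through [j + 1] and the two-step path
    from [j] to [j + 2] carry the same section [a_j a_(j+1)], so one can go from
    [j] to [j + 2], hence everywhere, with trivial section. *)
Lemma path1 x y : path x y 1.
Proof.
apply: (@ordSS_closed (fun y => path x y 1) x y); last first.
  by exists [::]; rewrite ?act_nil ?perm1 ?eval_nil.
move=> j xj; rewrite -[1]mulg1; apply: path_trans xj _.
have loop := path_trans (path_up j) (path_down j).
have := path_trans (path_inv loop) (path_trans (path_up j) (path_up (ordS j))).
by rewrite mulVg.
Qed.

Lemma path_any x y h : Gd h -> path x y h.
Proof.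
move=> /Gd_word[w ->]; elim: w => [|[i b] w IH]; first by rewrite eval_nil; exact: path1.
rewrite eval_cons; apply: path_trans IH.
have pg : path x x (gen i).
  rewrite -[gen i]mul1g -[1 * gen i]mulg1.
  exact: path_trans (path_trans (path1 _ _) (path_up i)) (path1 _ _).
by case: b => //; apply: path_inv.
Qed.

Definition place x h : 'I_d -> aut d := fun y => if y == x then h else 1.

Lemma realized_conj x h w : realized (place x h) ->
  realized (place (act w x) (h ^ eval (wsec x w))).
Proof.
move=> [g Gg eg]; have Gw := Gd_eval w; exists (g ^ eval w).
  by apply: (subgroupM sG); [exact: (subgroupV sG) | exact: (subgroupM sG)].
move=> y t; rewrite -(autKV (eval w) (y :: t)).
have : size ((eval w)^-1 (y :: t)) = (size t).+1 by rewrite size_aut.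
case e : ((eval w)^-1 _) => [//|z t'] _.
have {e} : eval w (z :: t') = y :: t by rewrite -e autKV.
rewrite eval_vertex => -[<- <-].
rewrite /conjg !autM -eval_vertex autK eg !eval_vertex /place.
rewrite (inj_eq (@perm_inj _ (act w))); congr cons.
by case: eqP => [->|//]; rewrite !autM autK.
Qed.

Definition placeable h := forall x, realized (place x h).

(** By self-replication, what can be placed below one vertex can be placed,
    together with all its conjugates, below every vertex. *)
Lemma placeable_conj x h g : Gd g -> realized (place x h) -> placeable (h ^ g).
Proof.
move=> Gg r y; have [w <- <-] := path_any x y Gg; exact: realized_conj.
Qed.

Lemma placeable1 : placeable 1.
Proof. by move=> x; apply: realized_ext realized1 => y; rewrite /place; case: ifP. Qed.

Lemma placeableM g h : placeable g -> placeable h -> placeable (g * h).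
Proof.
move=> pg ph x; apply: realized_ext (realizedM (pg x) (ph x)) => y.
by rewrite /place; case: ifP; rewrite ?mulg1.
Qed.

(** The defect of the braid relation between [a_i] and [a_(i+1)] lives
    below the single vertex [i + 1]. *)
Lemma placeable_braid i : placeable (gen i * (gen (ordS (ordS i)))^-1).
Proof.
set a := gen i; set c := gen (ordS (ordS i)).
have -> : a * c^-1 = ((a * c^-1) ^ (gen (ordS i))^-1) ^ gen (ordS i) by rewrite conjgKV.
apply: (@placeable_conj (ordS i)); first by apply: sub_generated; exists (ordS i).
pose B := ordS i; pose C := ordS B.
have nBA : (B == i) = false by exact: negPf (ordS_neq hd _).
have nCB : (C == B) = false by exact: negPf (ordS_neq hd _).
have nCA : (C == i) = false by exact: negPf (ordSS_neq hd _).
have [nAB nBC nAC] : [/\ (i == B) = false, (B == C) = false & (i == C) = false].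
  by rewrite !(eq_sym _ B) !(eq_sym _ C).
pose w : word := [:: (i, true); (B, true); (i, true); (B, false); (i, false); (B, false)].
have lA b : lact (i, b) = tperm i B by [].
have lB b : lact (B, b) = tperm B C by [].
have mA b x : moves (i, b) x = (x == i) || (x == B) by [].
have mB b x : moves (B, b) x = (x == B) || (x == C) by [].
have tC : tperm i B C = C by rewrite tpermD ?nAC ?nBC.
have tA : tperm B C i = i by rewrite tpermD ?nBA ?nCA.
have simp := (lA, lB, mA, mB, tpermL, tpermR, tC, tA, nBA, nCB, nCA, nAB, nBC, nAC, eqxx).
have secE x : wsec x w = if x == i then [:: (i, true); (B, true); (B, false); (i, false)]
    else if x == B then [:: (B, true); (i, true); (C, false); (B, false)]
    else if x == C then [:: (C, true); (B, true); (B, false); (C, false)] else [::].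
  rewrite /= /lsec; case: eqP => [->|/eqP/negPf xA]; first by rewrite !simp.
  case: eqP => [->|/eqP/negPf xB]; first by rewrite !simp.
  case: eqP => [->|/eqP/negPf xC]; first by rewrite !simp.
  have tAx : tperm i B x = x by rewrite tpermD // eq_sym ?xA ?xB.
  have tBx : tperm B C x = x by rewrite tpermD // eq_sym ?xC ?xB.
  by rewrite !(lA, lB, mA, mB, tAx, tBx, xA, xB, xC).
have aw : act w = 1.
  rewrite /w !act_cons act_nil !lA !lB; apply/permP => x; rewrite !permM !perm1.
  have [->|xA] := eqVneq x i; first by rewrite !simp.
  have [->|xB] := eqVneq x B; first by rewrite !simp.
  have [->|xC] := eqVneq x C; first by rewrite !simp.
  by rewrite !(tpermD (z := x)) // eq_sym.
apply: realized_ext (realized_word aw) => x; rewrite secE /place.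
have [->|xA] := eqVneq x i.
  by rewrite -[ordS i]/B nAB !eval_cons eval_nil /leval /= mulg1 mulKVg mulgV.
have [_|_] := eqVneq x B.
  by rewrite !eval_cons eval_nil /leval /= mulg1 /conjg invgK !mulgA.
have [_|_] := eqVneq x C; last by rewrite eval_nil.
by rewrite !eval_cons eval_nil /leval /= mulg1 mulKVg mulgV.
Qed.

Lemma placeable_quot i j : placeable (gen i * (gen j)^-1).
Proof.
apply: (@ordSS_closed (fun j => placeable (gen i * (gen j)^-1)) i j).
  move=> x px; rewrite -[gen i](mulgVK (gen x)) -mulgA.
  exact: placeableM (placeable_braid x).
by rewrite mulgV; exact: placeable1.
Qed.

(** Modulo the placeable elements all generators agree, so only the exponent
    sum remains of a word. *)
Lemma placeable_expsum0 w : expsum w = 0%R -> placeable (eval w).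
Proof.
have d0 : 0 < d by apply: leq_trans hd.
pose a : aut d := gen (Ordinal d0).
have Ga : Gd a by apply: sub_generated; exists (Ordinal d0).
have conj g h : Gd g -> placeable h -> placeable (h ^ g).
  by move=> Gg ph; apply: (placeable_conj Gg (ph (Ordinal d0))).
suff [p [q [-> pw]]] : exists p q : nat, expsum w = (p%:Z - q%:Z)%R /\
    placeable (eval w * a ^+ q * (a ^+ p)^-1).
  move/eqP; rewrite subr_eq0 eqz_nat => /eqP pq; move: pw.
  by rewrite pq mulgK.
elim: w => [|[i b] w [p [q [ew pw]]]].
  exists 0%N, 0%N; rewrite expsum_nil eval_nil !expg0; split=> //.
  by rewrite mulg1 mulgV; exact: placeable1.
rewrite expsum_cons eval_cons ew /sgl; case: b => /=.
  exists p.+1, q; split; first by lia.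
  have -> : leval (i, true) * eval w * a ^+ q * (a ^+ p.+1)^-1 =
      (gen i * a^-1) * (eval w * a ^+ q * (a ^+ p)^-1) ^ a^-1.
    by rewrite /leval /conjg /= expgS invgM invgK !mulgA mulgVK.
  by apply: placeableM (placeable_quot _ _) (conj _ _ (subgroupV sG Ga) pw).
exists p, q.+1; split; first by lia.
have -> : leval (i, false) * eval w * a ^+ q.+1 * (a ^+ p)^-1 =
    (a * (gen i)^-1) ^ a * (eval w * a ^+ q * (a ^+ p)^-1) ^ a.
  rewrite /leval /conjg /= !mulgA mulVg mul1g mulgK expgSr.
  rewrite -!mulgA; do 3!congr (_ * _).
  exact: commuteV (commuteX p (commute_refl a)).
by apply: placeableM (conj _ _ Ga pw); apply: conj => //; apply: placeable_quot.
Qed.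

End Branching.

(** * Exponent vectors on the first level *)

Section FirstLevel.
Variable d : nat.
Hypothesis hd : 3 <= d.
Hypothesis oddd : odd d.
Local Notation vertex := (seq 'I_d).
Local Notation letter := ('I_d * bool)%type.
Local Notation word := (seq letter).
Implicit Types (x y z i j m : 'I_d) (u t p : vertex) (l : letter) (w : word).
Implicit Types (g h : aut d) (F : 'I_d -> word) (v : 'I_d -> int).

Lemma realized_prod (H : 'I_d -> aut d) :
  (forall x, realized (place x (H x))) -> realized H.
Proof.
move=> rH; have rs (s : seq 'I_d) : uniq s -> realized (fun y => if y \in s then H y else 1).
  elim: s => [|x s IH] /=; first by move=> _; exact: realized1.
  case/andP=> xs us; apply: realized_ext (realizedM (rH x) (IH us)) => y.
  rewrite /place in_cons; case: (eqVneq y x) => [->|_] /=; last by rewrite mul1g.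
  by rewrite (negPf xs) mulg1.
apply: realized_ext (rs _ (enum_uniq 'I_d)) => y.
by rewrite mem_enum.
Qed.

Definition attained v := exists2 F, realized (@eval d \o F) & forall x, expsum (F x) = v x.

Lemma attained_ext v v' : v =1 v' -> attained v -> attained v'.
Proof. by move=> e [F rF eF]; exists F => // x; rewrite eF e. Qed.

Lemma attainedD v v' : attained v -> attained v' -> attained (fun x => v x + v' x)%R.
Proof.
move=> [F rF eF] [F' rF' eF']; exists (fun x => F x ++ F' x); last first.
  by move=> x; rewrite expsum_cat eF eF'.
by apply: realized_ext (realizedM rF rF') => x; rewrite /= eval_cat.
Qed.

Lemma attainedN v : attained v -> attained (fun x => - v x)%R.
Proof.
move=> [F rF eF]; exists (fun x => winv (F x)); last by move=> x; rewrite expsum_winv eF.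
by apply: realized_ext (realizedV rF) => x; rewrite /= eval_winv.
Qed.

Lemma attained0 : attained (fun=> 0)%R.
Proof.
exists (fun=> [::]); last by move=> x; rewrite expsum_nil.
by apply: realized_ext (@realized1 d) => x; rewrite /= eval_nil.
Qed.

Lemma attainedZ (c : int) v : attained v -> attained (fun x => c * v x)%R.
Proof.
move=> av; have nat_mul (n : nat) : attained (fun x => n%:Z * v x)%R.
  elim: n => [|n IH]; first by apply: attained_ext attained0 => x; rewrite mul0r.
  by apply: attained_ext (attainedD av IH) => x; lia.
case: c => n; first exact: nat_mul.
by apply: attained_ext (attainedN (nat_mul n.+1)) => x; lia.
Qed.

Lemma attained_sum (f : 'I_d -> 'I_d -> int) : (forall y, attained (f y)) ->
  attained (fun x => \sum_y f y x)%R.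
Proof.
move=> af; elim: (index_enum _) => [|y r IH].
  by apply: attained_ext attained0 => x; rewrite big_nil.
by apply: attained_ext (attainedD (af y) IH) => x; rewrite big_cons.
Qed.

Lemma attained_word w : act w = 1 -> attained (fun x => expsum (wsec x w)).
Proof. by move=> w1; exists (fun x => wsec x w) => //; exact: realized_word. Qed.

(** Words with the same exponent sums differ by placeable sections. *)
Lemma attained_realized F : attained (fun x => expsum (F x)) -> realized (@eval d \o F).
Proof.
move=> [F' rF' eF]; have rc : realized (fun x => eval (winv (F' x) ++ F x)).
  apply: realized_prod => x; apply: (placeable_expsum0 oddd hd).
  by rewrite expsum_cat expsum_winv eF addNr.
apply: realized_ext (realizedM rF' rc) => x.
by rewrite /= eval_cat eval_winv mulVKg.
Qed.

Lemma expsum_wsec_cons x l w : expsum (wsec x (l :: w)) =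
  ((if moves l x then sgl l else 0) + expsum (wsec (lact l x) w))%R.
Proof.
rewrite /= expsum_cat /lsec; case: ifP => _; rewrite ?expsum_nil //.
by rewrite expsum_cons expsum_nil addr0.
Qed.

Lemma expsum_wsec_cat x w1 w2 : expsum (wsec x (w1 ++ w2)) =
  (expsum (wsec x w1) + expsum (wsec (act w1 x) w2))%R.
Proof. by rewrite wsec_cat expsum_cat. Qed.

(** The exponents at [x] and [y] always add up to 2: conjugation by a generator only
    shifts exponent from one to the other, and [s] measures the shift. *)
Definition swaps x y (s : int) w := act w = tperm x y /\
  forall z, expsum (wsec z w) =
    (if z == x then 1 + s else if z == y then 1 - s else 0)%R.

Lemma swaps_gen i : swaps i (ordS i) 0 [:: (i, true)].
Proof.
split=> [|z]; first by rewrite act_cons act_nil mulg1.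
rewrite expsum_wsec_cons /moves /= expsum_nil addr0 subr0.
by case: (z == i).
Qed.

(** Conjugation by [a_j] or by its inverse carries the moved point [j] to [j + 1],
    and the choice decides on which side the exponent is added. *)
Lemma swaps_step x j s w b : x != j -> x != ordS j -> swaps x j s w ->
  swaps x (ordS j) (s + sgl (j, b)) ((j, ~~ b) :: w ++ [:: (j, b)]).
Proof.
move=> xj xS [aw ew].
have nSj : (ordS j == j) = false by exact: negPf (ordS_neq hd j).
have sN : sgl (j, ~~ b) = (- sgl (j, b))%R by case: (b).
have fixx : tperm j (ordS j) x = x by rewrite tpermD // eq_sym.
have fixS : tperm x j (ordS j) = ordS j by rewrite tpermD // eq_sym nSj.
split=> [|z].
  rewrite act_cons act_cat aw act_cons act_nil mulg1 /lact /=.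
  by rewrite -{1}(tpermV j (ordS j)) -/(conjg _ _) tpermJ tpermL fixx.
rewrite expsum_wsec_cons expsum_wsec_cat expsum_wsec_cons aw ew /= expsum_nil.
rewrite /lact /moves /= sN addr0.
have [->|zx] := eqVneq z x.
  rewrite fixx eqxx tpermL (negPf xj) (negPf xS) eqxx /=; lia.
have [->|zS] := eqVneq z (ordS j).
  rewrite tpermR tpermR eqxx orbT (negPf xj) (negPf xS) /= [j == x]eq_sym (negPf xj).
  lia.
have [->|zj] := eqVneq z j.
  rewrite tpermL fixS eq_sym (negPf xS) nSj eqxx /=; lia.
have fixz : tperm j (ordS j) z = z by rewrite tpermD // eq_sym.
have fixz' : tperm x j z = z by rewrite tpermD // eq_sym.
by rewrite fixz fixz' (negPf zx) (negPf zj) (negPf zS).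
Qed.

Lemma swaps_chain i n : n.+1 < d ->
  exists w, swaps i (iter n.+1 (@ordS d) i) (odd n : nat)%:Z w.
Proof.
have neq k : 0 < k < d -> i != iter k (@ordS d) i.
  move=> /andP[k0 kd]; apply/eqP => /(congr1 (@nat_of_ord d)); rewrite val_iter_ordS.
  have li := ltn_ord i; have [lt|ge] := ltnP (i + k) d; first by rewrite modn_small //; lia.
  by rewrite -(subnKC ge) modnDl modn_small; lia.
elim: n => [|n IH] lt; first by exists [:: (i, true)]; exact: swaps_gen.
have [w sw] := IH (ltnW lt); set j := iter n.+1 _ i in sw.
have ij : i != j by apply: neq; lia.
have iS : i != ordS j by apply: (neq n.+2); lia.
exists ((j, ~~ ~~ odd n) :: w ++ [:: (j, ~~ odd n)]).
have := swaps_step (~~ odd n) ij iS sw.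
by rewrite [iter n.+2 _ _]iterS -/j /sgl /=; case: (odd n).
Qed.

(** Going once around the cycle, the chain of conjugates closes up at a
    neighbour; [d] odd makes it differ there from the generator. *)
Lemma attained_step j : attained (fun x => (x == ordS j)%:Z - (x == j)%:Z)%R.
Proof.
have nSj : (ordS j == j) = false by exact: negPf (ordS_neq hd j).
have [|w [aw ew]] := @swaps_chain (ordS j) (d - 2); first by lia.
have ej : iter (d - 2).+1 (@ordS d) (ordS j) = j.
  rewrite -iterSr; apply: ord_inj; rewrite val_iter_ordS.
  have -> : (d - 2).+2 = d by lia.
  by rewrite modnDr modn_small ?ltn_ord.
have o1 : odd (d - 2) by rewrite oddB ?oddd //; lia.
rewrite ej o1 in aw ew.
have w1 : act (w ++ [:: (j, false)]) = 1.
  by rewrite act_cat aw act_cons act_nil mulg1 /lact /= tpermC tperm2.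
apply: attained_ext (attained_word w1) => x.
rewrite expsum_wsec_cat ew aw expsum_wsec_cons /= expsum_nil addr0 /moves /=.
have [->|xS] := eqVneq x (ordS j); first by rewrite tpermL eqxx nSj /sgl /=.
have [->|xj] := eqVneq x j; first by rewrite tpermR eqxx orbT /sgl /=.
have fixx : tperm (ordS j) j x = x by rewrite tpermD // eq_sym.
by rewrite fixx (negPf xj) (negPf xS).
Qed.

Lemma attained_diff i j : attained (fun x => (x == j)%:Z - (x == i)%:Z)%R.
Proof.
apply: (@ordS_closed _ (fun j => attained (fun x => (x == j)%:Z - (x == i)%:Z)%R) i j).
  by move=> y ay; apply: attained_ext (attainedD (attained_step y) ay) => x; lia.
by apply: attained_ext attained0 => x; rewrite subrr.
Qed.

Lemma attained4 i : attained (fun x => 4 * (x == i)%:Z)%R.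
Proof.
have w1 : act [:: (i, true); (i, true)] = 1.
  by rewrite !act_cons act_nil mulg1 /lact /= tperm2.
have sq := attained_word w1.
apply: attained_ext (attainedD sq (attainedZ 2 (attained_diff (ordS i) i))) => x.
rewrite !expsum_wsec_cons /= expsum_nil addr0 moves_lact /moves /= /sgl /=.
have [->|xi] := eqVneq x i; first by rewrite [i == ordS i]eq_sym (negPf (ordS_neq hd i)).
by case: (x == ordS i).
Qed.

(** The differences of unit vectors and 4 times a unit vector generate the
    vectors whose sum is divisible by 4. *)
Lemma attained_sum4 v (c : int) : (\sum_x v x = 4 * c)%R -> attained v.
Proof.
move=> sv; have d0 : 0 < d by apply: leq_trans hd.
pose o := Ordinal d0.
have a1 := attained_sum (fun y => attainedZ (v y) (attained_diff o y)).
apply: attained_ext (attainedD a1 (attainedZ c (attained4 o))) => x.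
under eq_bigr => y _ do rewrite mulrBr.
rewrite big_split /= sumrN -mulr_suml sv (bigD1 x) //= eqxx mulr1 big1.
  by lia.
by move=> y /negPf; rewrite eq_sym => ->; rewrite mulr0.
Qed.

Lemma realized_sum4 F (c : int) : (\sum_x expsum (F x) = 4 * c)%R -> realized (@eval d \o F).
Proof. by move=> /attained_sum4; exact: attained_realized. Qed.

End FirstLevel.

(** * Sums over the leaves below a vertex *)

Section LeafSums.
Variable d : nat.
Local Notation vertex := (seq 'I_d).
Implicit Types (x y z i j : 'I_d) (u t p q : vertex) (f : vertex -> int).
Local Open Scope ring_scope.

Fixpoint leafsum n f : int :=
  if n is n'.+1 then \sum_x leafsum n' (fun u => f (x :: u)) else f [::].

Definition blocksum k f p := leafsum (k - size p) (fun u => f (p ++ u)).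

Lemma eq_leafsum n f f' : (forall u, size u = n -> f u = f' u) ->
  leafsum n f = leafsum n f'.
Proof.
elim: n f f' => [|n IH] f f' e /=; first exact: e.
by apply: eq_bigr => x _; apply: IH => u su; apply: e; rewrite /= su.
Qed.

Lemma leafsumD n f f' : leafsum n (fun u => f u + f' u) = leafsum n f + leafsum n f'.
Proof. by elim: n f f' => //= n IH f f'; rewrite -big_split; apply: eq_bigr => x _; rewrite IH. Qed.

Lemma eq_blocksum k f f' p : (forall u, size u = k -> f u = f' u) -> (size p <= k)%N ->
  blocksum k f p = blocksum k f' p.
Proof. by move=> e pk; apply: eq_leafsum => u su; apply: e; rewrite size_cat su subnKC. Qed.

Lemma blocksumD k f f' p :
  blocksum k (fun u => f u + f' u) p = blocksum k f p + blocksum k f' p.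
Proof. exact: leafsumD. Qed.

Lemma blocksum_leaf f p : blocksum (size p) f p = f p.
Proof. by rewrite /blocksum subnn /= cats0. Qed.

Lemma blocksum_rcons k f p : (size p < k)%N ->
  blocksum k f p = \sum_x blocksum k f (rcons p x).
Proof.
move=> pk; rewrite /blocksum -(subnSK pk) /=; apply: eq_bigr => x _.
rewrite size_rcons; apply: eq_leafsum => u _; by rewrite cat_rcons.
Qed.

Lemma dvdz_leafsum n f (c : int) : (forall u, size u = n -> (c %| f u)%Z) ->
  (c %| leafsum n f)%Z.
Proof.
elim: n f => [|n IH] f cf /=; first exact: cf.
by apply: rpred_sum => x _; apply: IH => u su; apply: cf; rewrite /= su.
Qed.

Lemma leafsum0 n f : (forall u, size u = n -> f u = 0) -> leafsum n f = 0.
Proof.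
elim: n f => [|n IH] f f0 /=; first exact: f0.
by apply: big1 => x _; apply: IH => u su; apply: f0; rewrite /= su.
Qed.

Lemma leafsum_single n f u0 : size u0 = n ->
  (forall u, size u = n -> u != u0 -> f u = 0) -> leafsum n f = f u0.
Proof.
elim: n f u0 => [|n IH] f [|x u0] //= [su] f0.
rewrite (bigD1 x) //= (IH _ u0) //; last first.
  by move=> u su' nu; apply: f0; rewrite /= ?su' // eqseq_cons eqxx.
rewrite big1 ?addr0 // => y yx; apply: leafsum0 => u su'.
by apply: f0; rewrite /= ?su' // eqseq_cons (negPf yx).
Qed.

Variable o : 'I_d.

(** Total sum and block sums at the vertices that are not leftmost among their
    siblings are free coordinates, since the leftmost block has to make up for the rest of
    its parent. The root is excluded by the default value of [last]. *)
Lemma blocksum_prescribed k (T : vertex -> int) (c : int) : exists f,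
  leafsum k f = c /\
  forall p, (size p <= k)%N -> last o p != o -> blocksum k f p = T p.
Proof.
elim: k T c => [|k IH] T c.
  by exists (fun=> c); split=> // -[|//] _; rewrite /= eqxx.
pose cx x := if x == o then c - \sum_(y | y != o) T [:: y] else T [:: x].
have [f ef] := choice (fun x => IH (fun p => T (x :: p)) (cx x)).
exists (fun u => if u is x :: u' then f x u' else 0); split=> [/=|[|x p]] /=.
- rewrite (eq_bigr cx) => [|x _]; last by case: (ef x).
  rewrite (bigD1 o) //= {1}/cx eqxx (eq_bigr (fun y => T [:: y])) ?subrK //.
  by move=> y /negPf yo; rewrite /cx yo.
- by rewrite eqxx.
- rewrite ltnS => pk lp; have [fx ex] := ef x.
  rewrite /blocksum /= subSS; case: p pk lp => [|y p] pk lp.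
    by rewrite subn0 fx /cx (negPf lp).
  exact: ex.
Qed.

(** The leftmost child of a vertex is the vertex minus the other children. *)
Lemma dvdz_blocksum k f (c : nat -> int) :
  (forall s, (s < k)%N -> (c s %| c s.+1)%Z) -> (c k %| leafsum k f)%Z ->
  (forall p, (size p <= k)%N -> last o p != o -> (c (k - size p)%N %| blocksum k f p)%Z) ->
  forall p, (size p <= k)%N -> (c (k - size p)%N %| blocksum k f p)%Z.
Proof.
move=> cS ck cd; elim/last_ind => [|p x IH]; first by rewrite /blocksum subn0.
rewrite size_rcons => pk.
have [->|xo] := eqVneq x o; last first.
  by rewrite -(size_rcons p x); apply: cd; rewrite ?size_rcons ?last_rcons.
have := IH (ltnW pk); rewrite blocksum_rcons // (bigD1 o) //= => dv.
have cc : (c (k - (size p).+1)%N %| c (k - size p)%N)%Z by rewrite -(subnSK pk); apply: cS; lia.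
have := dvdz_trans cc dv; rewrite rpredDr //.
apply: rpred_sum => y yo; rewrite -(size_rcons p y).
by apply: cd; rewrite ?size_rcons ?last_rcons.
Qed.

End LeafSums.

(** * Numbering the vertices that are not leftmost *)

Section Numbering.
Variable d : nat.
Local Notation vertex := (seq 'I_d).
Implicit Types (x y : 'I_d) (u t p q : vertex).
Local Open Scope nat_scope.

Definition number p := foldl (fun n x => n * d + x) 0 p.

Lemma number_rcons p x : number (rcons p x) = number p * d + x.
Proof. by rewrite /number foldl_rcons. Qed.

Lemma number_lt p : number p < d ^ size p.
Proof.
elim/last_ind: p => // p x IH; rewrite number_rcons size_rcons expnSr.
by have lx := ltn_ord x; apply: (@leq_trans ((number p).+1 * d)); [lia | rewrite leq_mul2r IH orbT].
Qed.

Hypothesis d1 : 1 < d.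
Let d0 : 0 < d := ltnW d1.
Let o : 'I_d := Ordinal d0.

Fixpoint digits m n : vertex :=
  if m is m'.+1 then rcons (digits m' (n %/ d)) (Ordinal (ltn_pmod n d0)) else [::].

Lemma size_digits m n : size (digits m n) = m.
Proof. by elim: m n => //= m IH n; rewrite size_rcons IH. Qed.

Lemma digitsK m n : n < d ^ m -> number (digits m n) = n.
Proof.
elim: m n => [|m IH] n; first by case: n.
rewrite expnSr => lt; rewrite number_rcons IH ?ltn_divLR //=.
by rewrite -divn_eq.
Qed.

Lemma numberK p : digits (size p) (number p) = p.
Proof.
elim/last_ind: p => // p x IH; rewrite number_rcons size_rcons /=.
rewrite divnMDl // divn_small ?ltn_ord // addn0 IH; congr rcons.
by apply: ord_inj; rewrite /= modnMDl modn_small.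
Qed.

Lemma last_digits m n : last o (digits m.+1 n) = n %% d :> nat.
Proof. by rewrite /= last_rcons. Qed.

Lemma dval_spec i : 0 < i -> exists r, i = d ^ dval d i * r /\ ~~ (d %| r).
Proof.
move=> i0; suff [s [r [ei dr]]] : exists s r, i = d ^ s * r /\ ~~ (d %| r).
  by exists r; rewrite {2}ei dvalE.
elim/ltn_ind: i i0 => i IH i0; have [di|ndi] := boolP (d %| i); last first.
  by exists 0, i; rewrite expn0 mul1n.
have [|//|s [r [ei dr]]] := IH (i %/ d); first by rewrite ltn_Pdiv.
  by rewrite divn_gt0 // dvdn_leq.
by exists s.+1, r; split=> //; rewrite expnS -mulnA -ei mulnC divnK.
Qed.

Section Index.
Variable k : nat.

(** For [i = d^s r] with [d] not dividing [r], the leaves below this vertex are the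
    [d^s] ones numbered from [i]. *)
Definition vertex_of i : vertex := digits (k - dval d i) (i %/ d ^ dval d i).

Definition index_of p := number p * d ^ (k - size p).

Lemma dval_lt i : 0 < i < d ^ k -> dval d i < k.
Proof.
move=> /andP[i0 ik]; have [r [ei _]] := dval_spec i0.
rewrite -(ltn_exp2l _ _ d1); apply: leq_ltn_trans ik.
by rewrite {2}ei leq_pmulr //; case: r ei => // e; rewrite e muln0 in i0.
Qed.

Lemma index_bounds (i : 'I_(d ^ k).-1) : 0 < i.+1 < d ^ k.
Proof.
have lt : i.+1 < (d ^ k).-1.+1 by rewrite ltnS ltn_ord.
by rewrite prednK ?expn_gt0 ?d0 in lt.
Qed.

Lemma size_vertex_of i : size (vertex_of i) = k - dval d i.
Proof. by rewrite size_digits. Qed.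

Lemma last_vertex_of i : 0 < i < d ^ k -> last o (vertex_of i) != o.
Proof.
move=> ik; have := dval_lt ik; case/andP: ik => i0 _; rewrite /vertex_of => lt.
have [r [ei dr]] := dval_spec i0.
rewrite -(subnSK lt); apply: contraNneq dr => /(congr1 (@nat_of_ord d)).
by rewrite last_digits {1}ei mulKn ?expn_gt0 ?d0 // => /eqP.
Qed.

Lemma vertex_ofK i : 0 < i < d ^ k -> index_of (vertex_of i) = i.
Proof.
move=> ik; have lt := dval_lt ik; case/andP: ik => i0 ik; rewrite /index_of size_vertex_of.
have [r [ei dr]] := dval_spec i0.
have ds0 j : 0 < d ^ j by rewrite expn_gt0 d0.
rewrite digitsK ?subKn ?(ltnW lt) //; first by rewrite {1}ei mulKn // mulnC -ei.
by rewrite ltn_divLR // -expnD subnK // ltnW.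
Qed.

Lemma dval_index_of p : size p <= k -> last o p != o -> dval d (index_of p) = k - size p.
Proof.
case/lastP: p => [|p x]; first by rewrite eqxx.
rewrite last_rcons => _ xo; rewrite /index_of mulnC dvalE //.
rewrite number_rcons /dvdn modnMDl modn_small ?ltn_ord //.
Qed.

Lemma index_of_bounds p : size p <= k -> last o p != o -> 0 < index_of p < d ^ k.
Proof.
have ds0 j : 0 < d ^ j by rewrite expn_gt0 d0.
case/lastP: p => [|p x pk]; first by rewrite eqxx.
rewrite last_rcons => xo; rewrite /index_of muln_gt0 ds0 andbT; apply/andP; split.
  rewrite number_rcons addn_gt0; apply/orP; right; rewrite lt0n.
  by apply: contra xo => /eqP e; apply/eqP/ord_inj.
by rewrite -{2}(subnKC pk) expnD ltn_pmul2r // number_lt.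
Qed.

Lemma index_ofK p : size p <= k -> last o p != o -> vertex_of (index_of p) = p.
Proof.
move=> pk lp; rewrite /vertex_of dval_index_of // subKn // /index_of.
by rewrite mulnK ?expn_gt0 ?d0 // numberK.
Qed.

End Index.

End Numbering.

(** * The stabilizer of a level *)

Section Levels.
Variable d : nat.
Hypothesis hd : 3 <= d.
Local Notation vertex := (seq 'I_d).
Local Notation letter := ('I_d * bool)%type.
Local Notation word := (seq letter).
Implicit Types (x y z i j m : 'I_d) (u t p : vertex) (l : letter) (w : word).
Implicit Types (f : vertex -> int) (g h : aut d).

Let d1 : 1 < d := ltnW hd.
Let d0 : 0 < d := ltnW d1.

Definition fixes k g := forall u, size u = k -> g u = u.

Lemma fixes_above k g u : fixes k g -> size u <= k -> g u = u.
Proof.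
move=> fg uk; pose o : 'I_d := Ordinal d0.
have := fg (u ++ nseq (k - size u) o); rewrite size_cat size_nseq subnKC // => /(_ erefl) e.
have := prefix_aut g u (u ++ nseq (k - size u) o); rewrite e prefix_prefix.
by case/prefixP=> t /eqP; rewrite eqseq_cat ?size_aut // => /andP[/eqP].
Qed.

(** The sections of a stabilizer element strictly above the leaves have even exponent
    sum, and descending to the leaves doubles it [s] times; at the leaves
    themselves there is no condition. *)
Definition modulus s : nat := if s is 0 then 1 else 2 ^ s.+1.

Definition balanced k f :=
  forall p, size p <= k -> ((modulus (k - size p))%:Z %| blocksum k f p)%Z.

Lemma dvdn_modulus s : (modulus s %| modulus s.+1)%N.
Proof. by case: s => [|s] //=; rewrite dvdn_exp2l. Qed.

Lemma leafsum_vsec n w :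
  leafsum n (fun u => expsum (vsec u w)) = ((2 ^ n)%:Z * expsum w)%R.
Proof.
elim: n w => [|n IH] w /=; first by rewrite mul1r.
rewrite (eq_bigr (fun x => (2 ^ n)%:Z * expsum (wsec x w)))%R => [|x _]; last exact: IH.
by rewrite -mulr_sumr sum_wsec // expnS; lia.
Qed.

Lemma balanced_vsec k w : fixes k (eval w) -> balanced k (fun u => expsum (vsec u w)).
Proof.
move=> fw p; rewrite /blocksum leq_eqVlt => /orP[/eqP->|pk].
  by rewrite subnn dvdzE /= dvd1n.
rewrite (@eq_leafsum _ _ _ (fun u => expsum (vsec u (vsec p w)))); last first.
  by move=> u _; rewrite vsec_cat.
rewrite leafsum_vsec -(subnSK pk) /modulus.
have [|m ->] := @expsum_even_act d hd (vsec p w).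
  apply/permP => x; rewrite perm1; have := eval_vertex_cat w p [:: x].
  rewrite !(fixes_above fw) ?size_cat ?addn1 // ?(ltnW pk) // => /eqP.
  by rewrite eqseq_cat // eqxx /= => /eqP; rewrite eval_vertex => -[].
by apply/dvdzP; exists m; rewrite [(2 ^ _.+2)%N]expnS; lia.
Qed.

(** Sections are read off a word; the choice of the word does not matter for
    the exponent sums. *)
Definition wordof g : word := xget [::] [set w | eval w = g]%classic.

Lemma wordofK g : Gd g -> eval (wordof g) = g.
Proof. by move=> /Gd_word[w e]; apply: (@xgetPex _ [::] [set w | eval w = g]%classic); exists w. Qed.

Definition leafexp g u : int := expsum (vsec u (wordof g)).

Lemma leafexp_eval w u : leafexp (eval w) u = expsum (vsec u w).
Proof. by apply: (expsum_eval hd); apply: eval_vsec; apply: wordofK; apply: Gd_eval. Qed.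

Lemma leafexpM g h u : Gd g -> Gd h -> g u = u ->
  leafexp (g * h) u = (leafexp g u + leafexp h u)%R.
Proof.
move=> /Gd_word[w ->] /Gd_word[w' ->] fu.
by rewrite -eval_cat !leafexp_eval vsec_cat_word expsum_cat fu.
Qed.

Lemma balanced_leafexp k g : St k g -> balanced k (leafexp g).
Proof.
move=> [Gg fg]; move: fg; rewrite -(wordofK Gg) => fg p pk.
rewrite (@eq_blocksum _ _ _ (fun u => expsum (vsec u (wordof g)))) //.
  exact: balanced_vsec.
by move=> u _; exact: leafexp_eval.
Qed.

Lemma section_eq1 w u : (forall t, eval w (u ++ t) = u ++ t) -> eval (vsec u w) = 1.
Proof.
move=> fw; apply: autP => t; have := eval_vertex_cat w u t.
rewrite fw => /eqP; rewrite eqseq_cat ?size_aut // => /andP[_ /eqP <-] //.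
Qed.

(** An element of a rigid stabilizer has a single nonzero leaf exponent, which
    is therefore the total sum. *)
Lemma leafexp_Rist_vertex k u0 g u : 0 < k -> size u0 = k -> size u = k ->
  Rist_vertex u0 g -> ((2 ^ k.+1)%:Z %| leafexp g u)%Z.
Proof.
move=> k0 s0 su [Gg fg].
have off v t : size v = k -> v != u0 -> ~~ prefix u0 (v ++ t).
  move=> sv; apply: contra => /prefixP[t' /eqP]; rewrite eqseq_cat ?sv ?s0 //.
  by case/andP.
have z0 v : size v = k -> v != u0 -> leafexp g v = 0%R.
  move=> sv nv; rewrite -(wordofK Gg) leafexp_eval.
  apply: (expsum_relator hd); apply: section_eq1 => t; rewrite wordofK //.
  by apply: fg; apply: off.
have [->|nu] := eqVneq u u0; last by rewrite z0 ?dvdz0.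
have fv v : size v = k -> v != u0 -> g v = v.
  by move=> sv nv; apply: fg; rewrite -[v]cats0 off.
have sg : St k g.
  split=> // v sv; have [->|nv] := eqVneq v u0; last exact: fv.
  have [//|n0] := eqVneq (g u0) u0.
  by apply: (bij_inj (aut_bij g)); apply: fv; rewrite ?size_aut.
have := balanced_leafexp sg (leq0n k : size [::] <= k).
by rewrite /blocksum subn0 (leafsum_single s0) // /modulus; case: (k) k0.
Qed.


Hypothesis oddd : odd d.

(** Conversely balance suffices, by descending from the root: the sections of
    the first level exist by induction, and their exponent sums, being the
    block sums divided by a power of 2, add up to a multiple of 4. *)
Lemma balanced_realized k (F : vertex -> word) : balanced k (fun u => expsum (F u)) ->
  exists w, forall u t, size u = k -> eval w (u ++ t) = u ++ eval (F u) t.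
Proof.
elim: k F => [|k IH] F bF; first by exists (F [::]) => -[].
have [|W eW] := @choice _ _ (fun x w => forall u t, size u = k ->
    eval w (u ++ t) = u ++ eval (F (x :: u)) t).
  by move=> x; apply: (IH (fun u => F (x :: u))) => p pk; exact: (bF (x :: p)).
have sW x : leafsum k (fun u => expsum (F (x :: u))) = ((2 ^ k)%:Z * expsum (W x))%R.
  rewrite -leafsum_vsec; apply: eq_leafsum => u su; apply: (expsum_eval hd).
  apply: autP => t; have := eW x u t su; rewrite eval_vertex_cat => /eqP.
  by rewrite eqseq_cat ?size_aut // => /andP[_ /eqP].
have [c ec] : exists c, (\sum_x expsum (W x) = 4 * c)%R.
  have := bF [::] isT; rewrite /blocksum subn0 /= (eq_bigr _ (fun x _ => sW x)).
  rewrite -mulr_sumr => /dvdzP[c ec]; exists c.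
  have p0 : ((2 ^ k)%:Z != 0)%R by rewrite eqz_nat -lt0n expn_gt0.
  by apply: (mulfI p0); rewrite ec !expnS; lia.
have [g /Gd_word[w ->] ew] := realized_sum4 hd oddd ec.
by exists w => -[//|x u] t [su]; rewrite cat_cons ew /= eW.
Qed.

End Levels.

(** * The first isomorphism theorem *)

Lemma first_isomorphism (gT hT : groupType) (G N : set gT) (nNG : normal_in N G)
    (phi : gT -> hT) :
  (forall g h, G g -> G h -> phi (g * h) = phi g * phi h) ->
  (forall y, exists2 g, G g & phi g = y) ->
  (forall g, G g -> (phi g = 1 <-> N g)) ->
  isomorphic (quot_group nNG) hT.
Proof.
move=> phiM phi_surj phi_ker; have [sG sN NG nN] := nNG.
pose rep (A : quot_group nNG) : gT := projT1 (cid2 (coset_setP A)).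
have Grep A : G (rep A) by rewrite /rep; case: (cid2 _).
have repE A : coset_set A = left_coset (rep A) N by rewrite /rep; case: (cid2 _).
have rep_phi A g : G g -> coset_set A = left_coset g N -> phi (rep A) = phi g.
  move=> Gg eA; have : left_coset g N (rep A).
    by rewrite -eA repE; exists 1; [exact: subgroup1 | rewrite mulg1].
  case=> n Nn <-; rewrite phiM //; last exact: NG.
  by rewrite (phi_ker n (NG _ Nn)).2 ?mulg1.
have cosP g (Gg : G g) : exists2 h, G h & left_coset g N = left_coset h N by exists g.
pose sec y := projT1 (cid2 (phi_surj y)).
have Gsec y : G (sec y) by rewrite /sec; case: (cid2 _).
have secE y : phi (sec y) = y by rewrite /sec; case: (cid2 _).
exists (phi \o rep); split=> [|A B /=]; last first.
  rewrite -phiM //; apply: rep_phi; first exact: (subgroupM sG).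
  by rewrite /= !repE (mul_left_coset nNG).
exists (fun y => Coset nNG (cosP _ (Gsec y))) => [A|y] /=; last first.
  by rewrite (rep_phi _ (sec y)).
apply: coset_set_inj; rewrite /= repE.
set y := phi (rep A); have e : phi (rep A) = phi (sec y) by rewrite secE.
have Nn : N ((rep A)^-1 * sec y).
  apply/phi_ker; first by apply: (subgroupM sG) => //; exact: (subgroupV sG).
  have GV := subgroupV sG (Grep A).
  rewrite phiM // -e -phiM // mulVg; apply/phi_ker; first exact: (subgroup1 sG).
  exact: (subgroup1 sN).
apply/seteqP; split=> [_ [n Nn' <-]|_ [n Nn' <-]].
  exists ((rep A)^-1 * sec y * n); first exact: (subgroupM sN).
  by rewrite !mulgA mulgV mul1g.
exists (((rep A)^-1 * sec y)^-1 * n); first by apply: (subgroupM sN) => //; exact: (subgroupV sN).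
by rewrite invgM invgK !mulgA mulgV mul1g.
Qed.

(** * The coordinates of a stabilizer element *)

Section Coordinates.
Variables d k : nat.
Hypothesis hd : 3 <= d.
Hypothesis oddd : odd d.
Hypothesis hk : 1 <= k.
Local Notation vertex := (seq 'I_d).
Local Notation letter := ('I_d * bool)%type.
Local Notation word := (seq letter).
Implicit Types (i : nat) (x y : 'I_d) (u t p : vertex) (l : letter) (w : word).
Implicit Types (f : vertex -> int) (g h : aut d).

Let d1 : 1 < d := ltnW hd.
Let o : 'I_d := Ordinal (ltnW d1).

Definition divisible f := forall u, size u = k -> ((2 ^ k.+1)%:Z %| f u)%Z.

Lemma modulus_neq0 s : ((modulus s)%:Z != 0)%R.
Proof. by rewrite eqz_nat -lt0n; case: s => //= s; rewrite expn_gt0. Qed.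

Lemma modulus_full s : s <= k -> (modulus s %| 2 ^ k.+1)%N.
Proof. by case: s => [|s] sk; rewrite ?dvd1n // dvdn_exp2l. Qed.

Lemma modulus_alpha i : 0 < i < d ^ k -> (modulus (dval d i) * alpha d k i = 2 ^ k.+1)%N.
Proof.
move=> ik; have lt := dval_lt d1 ik; case/andP: ik => i0 _.
have [r [ei dr]] := dval_spec d1 i0; rewrite /alpha.
case: (dval d i) ei lt => [|s] ei lt.
  by rewrite ei expn0 mul1n (negPf dr) mul1n.
rewrite {1}ei expnS -mulnA dvdn_mulr //= -expnD; congr (2 ^ _)%N; lia.
Qed.

(** An element with all leaf exponents divisible is the product of its sections, each
    placed alone at its leaf; each such family is balanced. *)
Lemma divisible_Rist g : St k g -> divisible (leafexp g) -> Rist k g.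
Proof.
move=> [Gg fg] dg; pose w := wordof g; have ew : eval w = g := wordofK Gg.
have dw u : size u = k -> ((2 ^ k.+1)%:Z %| expsum (vsec u w))%Z.
  by move=> su; have := dg u su; rewrite -ew (leafexp_eval hd).
have sR : subgroup (@Rist d k) := generated_subgroup _.
pose only u v : word := if v == u then vsec u w else [::].
have alone u : size u = k -> exists h, Rist k h /\
    forall v t, size v = k -> h (v ++ t) = v ++ eval (only u v) t.
  move=> su; have [p pk|h eh] := @balanced_realized _ hd oddd k (only u).
    apply: dvdz_trans (_ : ((2 ^ k.+1)%:Z %| _)%Z).
      by rewrite dvdzE modulus_full ?leq_subr.
    apply: dvdz_leafsum => v _; rewrite /only; case: ifP => _; last by rewrite expsum_nil dvdz0.
    exact: dw.
  exists (eval h); split=> //; apply: sub_generated; exists u => //; split; first exact: Gd_eval.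
  have fh : fixes k (eval h) by move=> v sv; rewrite -[v]cats0 eh // aut_root.
  move=> v nuv; case: (ltnP (size v) k) => kv; first exact: (fixes_above hd fh (ltnW kv)).
  rewrite -(cat_take_drop k v) eh ?size_takel // /only ifN ?eval_nil //.
  by apply: contra nuv => /eqP <-; rewrite prefix_take.
have prod (s : seq vertex) : (forall u, u \in s -> size u = k) -> exists h, Rist k h /\
    forall v t, size v = k -> h (v ++ t) = v ++ (if v \in s then eval (vsec v w) t else t).
  elim: s => [|u s IH] sk; first by exists 1; split=> [|//]; exact: subgroup1.
  have [|h [Rh eh]] := IH; first by move=> v vs; apply: sk; rewrite in_cons vs orbT.
  have [us|us] := boolP (u \in s).
    exists h; split=> // v t sv; rewrite eh // in_cons.
    by have [->|_] := eqVneq v u; rewrite ?us.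
  have [|h' [Rh' eh']] := alone u; first by apply: sk; rewrite mem_head.
  exists (h' * h); split=> [|v t sv]; first exact: (subgroupM sR Rh' Rh).
  rewrite autM eh' // eh // in_cons /only.
  by have [->|_] := eqVneq v u; rewrite /= ?(negPf us) ?eval_nil.
pose all_leaves : seq vertex := map (@tval k 'I_d) (enum {: k.-tuple 'I_d}).
have [|h [Rh eh]] := prod all_leaves; first by move=> u /mapP[x _ ->]; rewrite size_tuple.
suff -> : g = h by [].
have fh : fixes k h.
  by move=> v sv; rewrite -[v]cats0 eh //; case: ifP => _ //; rewrite aut_root.
apply: autP => v; case: (ltnP (size v) k) => kv.
  by rewrite (fixes_above hd fg (ltnW kv)) (fixes_above hd fh (ltnW kv)).
have st : size (take k v) = k by rewrite size_takel.
rewrite -(cat_take_drop k v) eh // -ew eval_vertex_cat ew fg //.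
suff -> : take k v \in all_leaves by [].
apply/mapP; exists (Tuple (introT eqP st)) => //.
by rewrite mem_enum.
Qed.

Lemma leafexp_div g h u : St k g -> St k h -> size u = k ->
  leafexp (g * h^-1) u = (leafexp g u - leafexp h u)%R.
Proof.
move=> Sg Sh su; have [_ SB] := St_subgroup d k.
have [Gq fq] := SB _ _ Sg Sh; have [Gh _] := Sh.
apply/eqP; rewrite eq_sym subr_eq -(leafexpM hd Gq Gh (fq u su)).
by rewrite mulgVK.
Qed.

Lemma Rist_divisible g : Rist k g -> St k g /\ divisible (leafexp g).
Proof.
suff : (Rist k `<=` [set g | St k g /\ divisible (leafexp g)])%classic by apply.
have sS := St_subgroup d k.
apply: generated_min => [|h [u /= su rh]].
  split=> [|h h' [Sh dh] [Sh' dh']] /=.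
    split=> [|u su]; first exact: (subgroup1 sS).
    by rewrite -[1](mulgV 1) leafexp_div ?subrr ?dvdz0 //; exact: (subgroup1 sS).
  split=> [|u su]; first by case: sS => _; apply.
  by rewrite leafexp_div // rpredB ?dh ?dh'.
split; last by move=> v sv; exact: (leafexp_Rist_vertex hd hk su sv rh).
have [_ _ RS _] := Rist_normal d k.
by apply: RS; apply: sub_generated; exists u.
Qed.

Definition coord g (i : nat) : int :=
  (blocksum k (leafexp g) (vertex_of d1 k i) %/ (modulus (dval d i))%:Z)%Z.

Definition coords g : cyclic_product d k :=
  [ffun i : 'I_(d ^ k).-1 => (coord g i.+1)%:~R%R : 'Z_(alpha d k i.+1)].

Lemma coordK g i : St k g -> 0 < i < d ^ k ->
  (coord g i * (modulus (dval d i))%:Z)%R = blocksum k (leafexp g) (vertex_of d1 k i).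
Proof.
move=> Sg ik; rewrite divzK // -[dval d i](subKn (ltnW (dval_lt d1 ik))).
rewrite -(size_vertex_of d1); apply: (balanced_leafexp hd Sg).
by rewrite size_vertex_of leq_subr.
Qed.

Lemma coordsM g h : St k g -> St k h -> coords (g * h) = coords g * coords h.
Proof.
move=> Sg Sh; apply/ffunP => i; rewrite mulg_ffun !ffunE FinRing.zmodMgE -rmorphD /=.
congr (_%:~R)%R; have ik := index_bounds d1 i.
apply: (mulIf (modulus_neq0 (dval d i.+1))); have Sgh := subgroupM (St_subgroup d k) Sg Sh.
rewrite mulrDl (coordK Sgh ik) (coordK Sg ik) (coordK Sh ik) -blocksumD.
apply: eq_blocksum => [u su|]; last first.
  by rewrite size_vertex_of leq_subr.
by case: Sg Sh => Gg fg [Gh fh]; apply: (leafexpM hd) => //; exact: fg.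
Qed.

Lemma intr_Zp_eq0 n (z : int) : 1 < n -> ((z%:~R == 0 :> 'Z_n) = (n%:Z %| z)%Z)%R.
Proof.
move=> n1; have natE (m : nat) : (m%:R == 0 :> 'Z_n)%R = (n %| m)%N.
  by rewrite -val_eqE /= Zp_nat /= Zp_cast.
case: z => m; rewrite dvdzE /= -natE //.
by rewrite NegzE rmorphN /= oppr_eq0.
Qed.

Lemma coords_eq1 g : St k g -> (coords g = 1 <-> Rist k g).
Proof.
move=> Sg; have coordE i : 0 < i < d ^ k -> ((coord g i)%:~R == 0 :> 'Z_(alpha d k i))%R =
    ((2 ^ k.+1)%:Z %| blocksum k (leafexp g) (vertex_of d1 k i))%Z.
  move=> ik; rewrite intr_Zp_eq0 ?alpha_gt1 // -(coordK Sg ik) -(modulus_alpha ik) PoszM mulrC.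
  by rewrite dvdz_mul2l // modulus_neq0.
split=> [c1|Rg]; last first.
  have [_ dg] := Rist_divisible Rg; apply/ffunP => i; rewrite oneg_ffun ffunE.
  apply/eqP; rewrite coordE ?index_bounds //; apply: dvdz_leafsum => u su.
  by apply: dg; rewrite size_cat su subnKC // size_vertex_of leq_subr.
apply: divisible_Rist => // u su.
rewrite -(blocksum_leaf _ u) su.
apply: (@dvdz_blocksum _ o _ _ (fun=> Posz (2 ^ k.+1))) => [//|||]; last by rewrite su.
  have := balanced_leafexp hd Sg (leq0n k : size [::] <= k).
  by rewrite /blocksum subn0 /modulus; case: (k) hk.
move=> p pk lp; have ik := index_of_bounds pk lp.
rewrite -(index_ofK pk lp) -coordE //.
have i0 : (index_of k p).-1 < (d ^ k).-1 by case/andP: ik; case: (d ^ k)%N => //; lia.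
have := congr1 (fun c : cyclic_product d k => c (Ordinal i0)) c1.
by rewrite oneg_ffun ffunE /= prednK; [move/eqP | case/andP: ik].
Qed.

Definition word_of_int (z : int) : word :=
  nseq `|z|%N (o, (0 <= z)%R).

Lemma expsum_word_of_int z : expsum (word_of_int z) = z.
Proof.
have expsum_nseq n l : expsum (nseq n l) = (n%:Z * sgl l)%R.
  elim: n => [|n IH]; first by rewrite expsum_nil mul0r.
  by rewrite expsum_cons IH; lia.
by rewrite expsum_nseq /sgl /=; case: z => n /=; lia.
Qed.

Lemma coords_surjective (c : cyclic_product d k) : exists2 g, St k g & coords g = c.
Proof.
pose C n : nat := if insub n.-1 is Some i then c i : nat else 0.
have [f [f0 fT]] := blocksum_prescribed o k
  (fun p => Posz (modulus (k - size p) * C (index_of k p))) 0%R.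
have bf : balanced k f.
  apply: (@dvdz_blocksum _ o _ _ (fun s => Posz (modulus s))) => [s _||p pk lp].
  - by rewrite dvdzE dvdn_modulus.
  - by rewrite f0 dvdz0.
  - by rewrite fT // PoszM dvdz_mulr.
have [|w ew] := @balanced_realized _ hd oddd k (word_of_int \o f).
  move=> p pk; rewrite (@eq_blocksum _ _ _ f) //; first exact: bf.
  by move=> u _ /=; rewrite expsum_word_of_int.
have Sw : St k (eval w).
  split; first exact: Gd_eval.
  by move=> u su; rewrite -[u]cats0 ew // aut_root.
have lw u : size u = k -> leafexp (eval w) u = f u.
  move=> su; rewrite (leafexp_eval hd) -[RHS]expsum_word_of_int; apply: (expsum_eval hd).
  apply: autP => t; have := eval_vertex_cat w u t; rewrite ew // => /eqP.
  by rewrite eqseq_cat ?size_aut // => /andP[_ /eqP <-].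
exists (eval w) => //; apply/ffunP => i; rewrite ffunE.
have ik := index_bounds d1 i; have dk := dval_lt d1 ik.
have pk : size (vertex_of d1 k i.+1) <= k by rewrite size_vertex_of leq_subr.
rewrite /coord (eq_blocksum lw pk) fT ?last_vertex_of // vertex_ofK //.
rewrite size_vertex_of subKn ?(ltnW dk) //.
rewrite PoszM mulKz ?modulus_neq0 //.
rewrite /C /= valK.
exact: natr_Zp.
Qed.

Lemma quotient_isomorphic : isomorphic (quot_group (Rist_normal d k)) (cyclic_product d k).
Proof.
apply: first_isomorphism coordsM coords_surjective coords_eq1.
Qed.

End Coordinates.

(** * The order of the quotient *)

Section Order.
Local Open Scope nat_scope.

Definition codepth d k i := if i == 0 then 0 else k - dval d i.

Lemma dvalM d i : 1 < d -> 0 < i -> dval d (i * d) = (dval d i).+1.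
Proof.
move=> d1 i0; have [r [ei dr]] := dval_spec d1 i0.
by rewrite {1}ei mulnC mulnA -expnS dvalE.
Qed.

Lemma dval_ndvd d i : 1 < d -> ~~ (d %| i) -> dval d i = 0.
Proof. by move=> d1 nd; rewrite -[i]mul1n -(expn0 d) dvalE. Qed.

Lemma sum_digits d n (F : nat -> nat) :
  \sum_(i < n * d) F i = \sum_(j < n) \sum_(x < d) F (j * d + x).
Proof.
elim: n => [|n IH]; first by rewrite mul0n !big_ord0.
by rewrite mulSnr big_split_ord /= IH [RHS]big_ord_recr.
Qed.

Lemma sum_split_digit d (c : nat) (F : nat -> nat) : 0 < d ->
  (forall x, 0 < x < d -> F x = c) -> \sum_(x < d) F x = F 0 + (d - 1) * c.
Proof.
case: d => // d _ Fc; rewrite big_ord_recl /= subn1 /=; congr (_ + _).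
rewrite (eq_bigr (fun=> c)) => [|x _]; first by rewrite sum_nat_const card_ord.
by apply: Fc; have := ltn_ord x; rewrite /bump /=; lia.
Qed.

Lemma dvdn_digit d j x : 0 < x < d -> ~~ (d %| j * d + x).
Proof. by move=> /andP[x0 xd]; rewrite /dvdn modnMDl modn_small //; lia. Qed.

(** The multiples of [d] below [d^(k+1)] repeat the sum for [k]; the other terms
    all equal [k + 1]. *)
Lemma sum_codepth_rec d k : 1 < d ->
  \sum_(i < d ^ k.+1) codepth d k.+1 i =
  \sum_(i < d ^ k) codepth d k i + d ^ k * ((d - 1) * k.+1).
Proof.
move=> d1; rewrite expnSr sum_digits.
rewrite (eq_bigr (fun j : 'I_(d ^ k) => codepth d k j + (d - 1) * k.+1)); last first.
  move=> j _; rewrite (@sum_split_digit d k.+1 (fun x => codepth d k.+1 (j * d + x))) //=.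
  - rewrite addn0 /codepth muln_eq0; case: (eqVneq (j : nat) 0) => [->|j0] //=.
    by rewrite (gtn_eqF (ltnW d1)) dvalM // lt0n.
  - exact: ltnW.
  - move=> x xd; rewrite /codepth; have nd := dvdn_digit j xd.
    rewrite dval_ndvd // subn0; case: eqP => // e; by rewrite e dvdn0 in nd.
by rewrite big_split /= sum_nat_const card_ord.
Qed.

Lemma sum_codepth d k : 1 < d ->
  (\sum_(i < d ^ k) codepth d k i) * (d - 1) + d ^ k = k * d ^ k * (d - 1) + 1.
Proof.
move=> d1; elim: k => [|k IH]; first by rewrite expn0 big_ord1 /codepth.
rewrite sum_codepth_rec // mulnDl -addnA.
have -> : d ^ k.+1 = d ^ k + d ^ k * (d - 1).
  by rewrite expnSr; case: d d1 {IH} => // d _; rewrite subn1 mulnS.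
move: IH; move: (\sum_(i < d ^ k) _) => S.
move: (d ^ k) (d - 1) => q e IH.
have -> : S * e + (q * (e * k.+1) * e + (q + q * e)) =
   (S * e + q) + (q * (e * k.+1) * e + q * e) by lia.
by rewrite IH; lia.
Qed.

Definition log_alpha d k i := if i == 0 then 0 else if d %| i then k - dval d i else k.+1.

Lemma sum_log_alpha d k : 1 < d ->
  \sum_(i < d ^ k.+1) log_alpha d k.+1 i =
  \sum_(i < d ^ k) codepth d k i + d ^ k * ((d - 1) * k.+2).
Proof.
move=> d1; rewrite expnSr sum_digits.
rewrite (eq_bigr (fun j : 'I_(d ^ k) => codepth d k j + (d - 1) * k.+2)); last first.
  move=> j _; rewrite (@sum_split_digit d k.+2 (fun x => log_alpha d k.+1 (j * d + x))) //=.
  - rewrite addn0 /log_alpha /codepth muln_eq0; case: (eqVneq (j : nat) 0) => [->|j0] //=.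
    by rewrite (gtn_eqF (ltnW d1)) dvdn_mull // dvalM // lt0n.
  - exact: ltnW.
  - move=> x xd; rewrite /log_alpha; have nd := dvdn_digit j xd.
    by rewrite (negPf nd); case: eqP => // e; rewrite e dvdn0 in nd.
by rewrite big_split /= sum_nat_const card_ord.
Qed.

Definition log_order d k := \sum_(i < (d ^ k).-1) log_alpha d k i.+1.

Lemma log_orderE d k : 1 < d ->
  log_order d k.+1 = \sum_(i < d ^ k) codepth d k i + d ^ k * ((d - 1) * k.+2).
Proof.
move=> d1; rewrite -sum_log_alpha // /log_order.
have : 0 < d ^ k.+1 by rewrite expn_gt0 ltnW.
by case: (d ^ k.+1) => // n _; rewrite big_ord_recl /= {1}/log_alpha /= add0n.
Qed.

Lemma log_order_formula d k : 1 < d -> 0 < k ->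
  (((log_order d k)%:R : rat) = ((k%:R + 1) * d%:R ^+ k.+1 - (k%:R + 3%:R) * d%:R ^+ k
             + d%:R ^+ k.-1 + 1) / (d%:R - 1))%R.
Proof.
move=> d1; case: k => // k _; rewrite log_orderE //=.
have e0 : (d%:R - 1 != 0 :> rat)%R by rewrite subr_eq0 (Num.Theory.eqr_nat _ d 1) gtn_eqF.
apply: (canRL (mulfK e0)).
have := sum_codepth k d1; move: (\sum_(i < d ^ k) _) => S eS.
have d1E : (d%:R - 1 = (d - 1)%:R :> rat)%R by rewrite natrB // ltnW.
have {eS} eS : (S%:R * (d%:R - 1) = k%:R * d%:R ^+ k * (d%:R - 1) + 1 - d%:R ^+ k :> rat)%R.
  by apply/eqP; rewrite eq_sym subr_eq d1E -natrX -!natrM -!natrD eS natrD.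
rewrite natrD mulrDl eS !natrM natrX -d1E -[k.+2%:R%R]natr1 -[k.+1%:R%R]natr1 !exprS.
ring.
Qed.

Lemma card_cyclic_product d k : 1 < d -> #|cyclic_product d k| = 2 ^ log_order d k.
Proof.
move=> d1; rewrite card_dep_ffun foldrE big_image /= /log_order expn_sum.
apply: eq_bigr => i _; rewrite card_ord Zp_cast ?alpha_gt1 ?index_bounds //.
by rewrite /alpha /log_alpha /=; case: ifP.
Qed.

Lemma card_isomorphic (gT : groupType) (hT : finGroupType) : isomorphic gT hT ->
  ([set: gT] #= `I_#|hT|)%classic%card.
Proof.
move=> [f [bf _]]; apply/card_set_bijP; exists (fun x => enum_rank (f x) : nat).
split=> [x _ /=|x y _ _ /ord_inj/enum_rank_inj/(bij_inj bf) //|n /= nlt].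
  exact: ltn_ord.
have [g fK gK] := bf; exists (g (enum_val (Ordinal nlt))) => //=.
by rewrite gK enum_valK.
Qed.

End Order.

Local Close Scope group_scope.

Theorem theorem4p12 (d k : nat) (hd : (3 <= d)%N) (oddd : odd d)
    (hk : (1 <= k)%N) :
  isomorphic (quot_group (Rist_normal d k)) (cyclic_product d k) /\
  exists t : nat,
    (t%:R = ((k%:R + 1) * d%:R ^+ k.+1 - (k%:R + 3%:R) * d%:R ^+ k
             + d%:R ^+ k.-1 + 1) / (d%:R - 1) :> rat)%R /\
    ([set: quot_group (Rist_normal d k)] #= `I_(2 ^ t)%classic)%card.
Proof.
have iso := quotient_isomorphic hd oddd hk.
split=> //; exists (log_order d k); split; first by apply: log_order_formula; lia.
rewrite -card_cyclic_product; last by lia.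
exact: card_isomorphic.
Qed.
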